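(* Let $\alpha<\omega_1$. Then there is a block subspace $X=[x_n]\subseteq W$ (with $(x_n)$ a block sequence) such that one of the following holds: (1) for every normalised block sequence $(y_n)$ in $X$ there is a sequence $I_0<I_1<I_2<\dots$ of finite intervals of $\mathbb N$ such that for every infinite $A\subseteq\mathbb N$, ${\rm Emb}\big((y_n),[x_j: j\notin\bigcup_{m\in A}I_m]\big)\le\omega\alpha$; (2) for every block subspace $Y\subseteq X$ and every block sequence $(z_n)$ in $X$, ${\rm Emb}\big((z_n),Y\big)>\alpha$.
   Context: Let $\mathcal W$ be a real Banach space with Schauder basis $(e_n)$. Fix a countable subfield $\mathfrak F\subseteq\mathbb R$ such that $\|\sum_{n\le m}a_ne_n\|\in\mathfrak F$ whenever all $a_n\in\mathfrak F$, and let $W$ be the $\mathfrak F$-vector space of finite $\mathfrak F$-linear combinations of the $e_n$, with the norm of $\mathcal W$; subspaces and spans $[\cdot]$ are $\mathfrak F$-linear in $W$. For nonzero $x=\sum a_ne_n$, ${\rm supp}(x)=\{n:a_n\neq0\}$, and $x<y$ means $\max{\rm supp}(x)<\min{\rm supp}(y)$; for finite sets of integers, $I<J$ means $\max I<\min J$. A block sequence is a sequence of nonzero vectors $x_0<x_1<\dots$ (normalised if all have norm $1$); a block subspace is the span of an infinite block sequence. $\omega\alpha$ is ordinal multiplication. $(x_i)_{i\le k}\sim_K(y_i)_{i\le k}$ means $\frac1K\|\sum a_ix_i\|\le\|\sum a_iy_i\|\le K\|\sum a_ix_i\|$ for all real $a_i$. $T((y_n),Z,K)$ is the tree of all finite sequences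 $(v_0,\dots,v_k)$ of vectors of $Z$, including the empty one, with $(v_0,\dots,v_k)\sim_K(y_0,\dots,y_k)$. For a well-founded tree $T$, $\rho_T(s)=\sup\{\rho_T(t)+1:s\prec t\in T\}$ ($0$ at terminal nodes), ${\rm rank}(T)=\sup\{\rho_T(s)+1:s\in T\}$; ill-founded trees have rank $\infty>\gamma$ for all ordinals $\gamma$. ${\rm Emb}((y_n),Z)=\sup_{K\ge1}{\rm rank}(T((y_n),Z,K))$. *)

(* Defs.v *)
From HB Require Import structures.
From mathcomp Require Import all_boot all_order all_algebra.
From mathcomp Require Import all_classical all_reals all_analysis.
Import Order.TTheory GRing.Theory Num.Theory.
Import numFieldNormedType.Exports.

Set Implicit Arguments.
Unset Strict Implicit.
Unset Printing Implicit Defensive.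

Local Open Scope classical_set_scope.
Local Open Scope ring_scope.

(* bZ = 0, bS b = b + 1, bL f = sup_n f n.  Every Brouwer ordinal denotes a
   countable ordinal and every countable ordinal is denoted by one. *)
Inductive bord : Type := bZ | bS of bord | bL of (nat -> bord).

Fixpoint badd_nat (b : bord) (n : nat) : bord :=
  match n with O => b | S k => bS (badd_nat b k) end.

(* omega * b  (ordinal multiplication):  omega*0 = 0,
   omega*(b+1) = omega*b + omega = sup_n (omega*b + n),
   omega*(sup f) = sup_n omega*(f n). *)
Fixpoint omega_mul (b : bord) : bord :=
  match b with
  | bZ => bZ
  | bS c => bL (badd_nat (omega_mul c))
  | bL f => bL (fun n => omega_mul (f n))
  end.

(* A tree is a set of finite sequences; t properly extends s iff t = s ++ u
   with u nonempty.  [rank_lt T s b] means rho_T(s) < b, by recursion on b: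
   nothing is < 0; rho(s) < b+1 iff rho(s) <= b iff rho(t) < b for every
   proper extension t of s in T; rho(s) < sup f iff rho(s) < f n for some n.
   On ill-founded branches it is never true (rank infinity). *)
Fixpoint rank_lt (X : Type) (T : seq X -> Prop) (s : seq X) (b : bord) : Prop :=
  match b with
  | bZ => False
  | bS c => forall u : seq X, u <> [::] -> T (s ++ u) -> rank_lt T (s ++ u) c
  | bL f => exists n, rank_lt T s (f n)
  end.

(* rank(T) = sup { rho_T(s) + 1 : s in T } <= b *)
Definition tree_rank_le (X : Type) (T : seq X -> Prop) (b : bord) : Prop :=
  forall s, T s -> rank_lt T s b.

Section Banach.
Variables (R : realType) (V : normedModType R).

Definition basis_expansion (e : nat -> V) (x : V) (a : nat -> R) : Prop :=
  (fun N : nat => \sum_(i < N) a i *: e i) @ \oo --> x.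

Definition schauder_basis (e : nat -> V) : Prop :=
  forall x : V, exists! a : nat -> R, basis_expansion e x a.

Definition is_subfield (F : set R) : Prop :=
  [/\ F 0, F 1, (forall x y, F x -> F y -> F (x - y)),
      (forall x y, F x -> F y -> F (x * y)) &
      (forall x, F x -> x != 0 -> F x^-1)].

Definition norm_closed (e : nat -> V) (F : set R) : Prop :=
  forall (m : nat) (a : nat -> R), (forall n, F (a n)) ->
    F `| \sum_(n < m.+1) a n *: e n |.

Definition inW (e : nat -> V) (F : set R) (x : V) : Prop :=
  exists (m : nat) (a : nat -> R),
    (forall n, F (a n)) /\ x = \sum_(n < m) a n *: e n.

Definition supp (e : nat -> V) (x : V) (n : nat) : Prop :=
  exists a : nat -> R, basis_expansion e x a /\ a n != 0.

Definition blk_lt (e : nat -> V) (x y : V) : Prop :=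
  forall i j, supp e x i -> supp e y j -> (i < j)%N.

Definition block_seq (e : nat -> V) (F : set R) (x : nat -> V) : Prop :=
  (forall n, inW e F (x n) /\ x n != 0) /\ (forall n, blk_lt e (x n) (x n.+1)).

Definition normalised (x : nat -> V) : Prop := forall n, `| x n | = 1.

Definition fspan_on (F : set R) (x : nat -> V) (P : nat -> Prop) : set V :=
  [set v | exists (k : nat) (b : nat -> R),
     (forall j, F (b j)) /\ (forall j, (j < k)%N -> b j != 0 -> P j) /\
     v = \sum_(j < k) b j *: x j].

Definition fspan (F : set R) (x : nat -> V) : set V := fspan_on F x (fun _ => True).

Definition equivK (K : R) (v : seq V) (y : nat -> V) : Prop :=
  forall a : nat -> R,
    K^-1 * `| \sum_(i < size v) a i *: nth 0 v i |
      <= `| \sum_(i < size v) a i *: y i |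
    /\ `| \sum_(i < size v) a i *: y i |
      <= K * `| \sum_(i < size v) a i *: nth 0 v i |.

Definition Ttree (y : nat -> V) (Z : set V) (K : R) : seq V -> Prop :=
  fun v => (forall i, (i < size v)%N -> Z (nth 0 v i)) /\ equivK K v y.

Definition Emb_le (y : nat -> V) (Z : set V) (b : bord) : Prop :=
  forall K : R, 1 <= K -> tree_rank_le (Ttree y Z K) b.

(* finite intervals I_0 < I_1 < ... ; I m = [(I m).1, (I m).2] *)
Definition interval_seq (I : nat -> nat * nat) : Prop :=
  forall m, ((I m).1 <= (I m).2)%N /\ ((I m).2 < (I m.+1).1)%N.

Definition in_union (I : nat -> nat * nat) (A : set nat) (j : nat) : Prop :=
  exists m, A m /\ ((I m).1 <= j)%N /\ (j <= (I m).2)%N.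

End Banach.

(* Main.v *)
Require Import Defs.
From HB Require Import structures.
From mathcomp Require Import all_boot all_order all_algebra.
From mathcomp Require Import all_classical all_reals all_analysis.
From mathcomp Require Import ring lra zify.
Import Order.TTheory GRing.Theory Num.Theory.
Import numFieldNormedType.Exports.
Set Implicit Arguments.
Unset Strict Implicit.
Unset Printing Implicit Defensive.
Local Open Scope classical_set_scope.
Local Open Scope ring_scope.

(** Two games of length [alpha] are played on a block sequence [x].  In the
asymptotic game player I shows finitely many vectors of a subspace [Y] and a tail
of [x], and player II answers with finitely many vectors of that tail, in whose
span (together with her earlier answers) she places images of the vectors of I;
she must keep the two families [K]-equivalent.  In the Gowers game I shows vectors
of a tail of [x] and an arbitrary block subspace in which II must answer.  An
induction on [alpha], with a diagonalisation over the countably many positions,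
yields [x] such that, for every integer [K], if II wins the asymptotic game for
some [Y] then she wins the Gowers game.  If she wins for some [Y], composing the
two strategies embeds any block sequence of [Y] into any block subspace of [Y] and
gives (2) for [Y].  Otherwise I wins all asymptotic games; the intervals [I_m] are
long enough to outrun the tails demanded by his strategies in the first positions,
and one round of the game costs finitely many vectors, whence the bound
[omega * alpha] in (1). *)

(** * Spans over an arbitrary set of scalars, so that [F]-spans and real spans are handled
    together *)

Inductive spn (R : realType) (U : lmodType R) (D : set R) (A : set U) : U -> Prop :=
| spn0 : spn D A 0
| spn_cons (a : R) (x v : U) : D a -> A x -> spn D A v ->
    spn D A (a *: x + v).
Arguments spn {R U} D A _.
Arguments spn0 {R U} D A.

Section Span.
Variable (R : realType).

Section OneSpace.
Variable (U : lmodType R).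
Implicit Types (D : set R) (A B : set U).

Lemma spn_sub D A B : A `<=` B -> spn D A `<=` spn D B.
Proof.
move=> AB v; elim=> [|a x w Da Ax _ IH]; first exact: spn0.
by apply: spn_cons => //; exact: AB.
Qed.

Lemma spn_coef D D' A : D `<=` D' -> spn D A `<=` spn D' A.
Proof.
move=> DD' v; elim=> [|a x w Da Ax _ IH]; first exact: spn0.
by apply: spn_cons => //; exact: DD'.
Qed.

Lemma spn_add D A u v : spn D A u -> spn D A v -> spn D A (u + v).
Proof.
move=> + Av; elim=> [|a x w Da Ax _ IH]; first by rewrite add0r.
by rewrite -addrA; exact: spn_cons.
Qed.

Lemma spn_scale D A a v : (forall x y, D x -> D y -> D (x * y)) ->
  D a -> spn D A v -> spn D A (a *: v).
Proof.
move=> DM Da; elim=> [|b x w Db Ax _ IH]; first by rewrite scaler0; exact: spn0.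
by rewrite scalerDr scalerA; apply: spn_cons => //; exact: DM.
Qed.

Lemma spn_mem D A x : D 1 -> A x -> spn D A x.
Proof.
by move=> D1 Ax; rewrite -(scale1r x) -(addr0 (_ *: x)); apply: spn_cons => //; exact: spn0.
Qed.

Lemma spn_trans D A B : (forall x y, D x -> D y -> D (x * y)) ->
  B `<=` spn D A -> spn D B `<=` spn D A.
Proof.
move=> DM BA v; elim=> [|a x w Da Ax _ IH]; first exact: spn0.
by apply: spn_add => //; apply: spn_scale => //; exact: BA.
Qed.

Lemma spn_min D A (P : set U) : P 0 ->
  (forall a x v, D a -> A x -> P v -> P (a *: x + v)) -> spn D A `<=` P.
Proof. by move=> P0 PD v; elim=> [//|a x w Da Ax _ IH]; exact: PD. Qed.

(** A combination involves finitely many generators, so in an increasing union they all occur at one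
    stage. *)
Lemma spn_directed D (A : nat -> set U) v :
  (forall m n, (m <= n)%N -> A m `<=` A n) ->
  spn D (\bigcup_n A n) v -> exists n, spn D (A n) v.
Proof.
move=> Amono; elim=> [|a x w Da [m _ Ax] _ [n Hn]]; first by exists 0%N; exact: spn0.
exists (maxn m n); apply: spn_cons => //; first by apply: Amono Ax; exact: leq_maxl.
by apply: spn_sub Hn; apply: Amono; exact: leq_maxr.
Qed.

Lemma spn_sum D A (k : nat) (b : nat -> R) (x : nat -> U) :
  (forall j, (j < k)%N -> spn D A (b j *: x j)) -> spn D A (\sum_(j < k) b j *: x j).
Proof.
elim: k => [|k IH] H; first by rewrite big_ord0; exact: spn0.
rewrite big_ord_recr /=; apply: spn_add; last exact: H.
by apply: IH => j jk; apply: H; exact: ltnW.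
Qed.

Lemma spn_seqE D (x : nat -> U) (P : set nat) v :
  D 0 -> (forall a b, D a -> D b -> D (a + b)) ->
  spn D (x @` P) v ->
  exists (k : nat) (b : nat -> R), (forall j, D (b j)) /\
    (forall j, b j != 0 -> (j < k)%N /\ P j) /\ v = \sum_(j < k) b j *: x j.
Proof.
move=> D0 DD; elim=> [|a _ w Da [i Pi <-] _ [k [b [Db [bP ->]]]]].
  exists 0%N, (fun=> 0); split => //; split; first by move=> j; rewrite eqxx.
  by rewrite big_ord0.
exists (maxn k i.+1), (fun j => (if j == i then a else 0) + b j).
split=> [j|]; first by apply: DD => //; case: ifP.
split=> [j|].
  case: (eqVneq j i) => [->|ji]; first by rewrite leq_maxr.
  by rewrite add0r => /bP[jk Pj]; split => //; rewrite leq_max jk.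
under [RHS]eq_bigr => j _ do rewrite scalerDl.
rewrite [RHS]big_split /=; congr (_ + _).
  rewrite (bigD1 (Ordinal (leq_maxr k i.+1))) //= eqxx big1 ?addr0 // => j.
  by rewrite -val_eqE /= => /negPf ->; rewrite scale0r.
have -> : \sum_(j < k) b j *: x j = \sum_(j < maxn k i.+1 | (j < k)%N) b j *: x j.
  by rewrite (big_ord_widen _ (fun j => b j *: x j) (leq_maxl k i.+1)).
rewrite [RHS](bigID (fun j : 'I_(maxn k i.+1) => (j < k)%N)) /=.
rewrite [X in _ + X]big1 ?addr0 // => j jk.
have /eqP -> : b j == 0 by apply: contraNT jk => /bP[].
by rewrite scale0r.
Qed.

Lemma spn_fin D (x : nat -> U) n v :
  D 0 -> (forall a b, D a -> D b -> D (a + b)) ->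
  spn D (x @` [set j | (j < n)%N]) v ->
  exists b : nat -> R, (forall j, D (b j)) /\ v = \sum_(j < n) b j *: x j.
Proof.
move=> D0 DD; elim=> [|a _ w Da [i /= i_n <-] _ [b [Db ->]]].
  by exists (fun=> 0); split => //; rewrite big1 // => j _; rewrite scale0r.
exists (fun j => (if j == i then a else 0) + b j).
split=> [j|]; first by apply: DD => //; case: ifP.
under [RHS]eq_bigr => j _ do rewrite scalerDl.
rewrite [RHS]big_split /=; congr (_ + _).
rewrite (bigD1 (Ordinal i_n)) //= eqxx big1 ?addr0 // => j.
by rewrite -val_eqE /= => /negPf ->; rewrite scale0r.
Qed.

End OneSpace.

Lemma spn_image (U U' : lmodType R) (f : U -> U') D (A : set U) v : f 0 = 0 ->
  (forall a x y, f (a *: x + y) = a *: f x + f y) ->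
  spn D A v -> spn D (f @` A) (f v).
Proof.
move=> f0 fD; elim=> [|a x w Da Ax _ IH]; first by rewrite f0; exact: spn0.
by rewrite fD; apply: spn_cons => //; exists x.
Qed.

End Span.

(** * Linear relations, given as spans of pairs, and their composition *)

Section Pairs.
Variables (R : realType) (V : lmodType R).
Implicit Types (D : set R) (S : set (V * V)).

Lemma spn_snd D S p : spn D S p -> spn D (snd @` S) p.2.
Proof. exact: spn_image. Qed.

Lemma spn_lift D S u : spn D (fst @` S) u -> exists v, spn D S (u, v).
Proof.
elim=> [|a _ w Da [[x y] /= Sxy <-] _ [v Hv]]; first by exists 0; exact: spn0.
by exists (a *: y + v); exact: (@spn_cons _ _ _ _ a (x, y) (w, v)).
Qed.

Definition relcomp (S T : set (V * V)) : set (V * V) :=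
  [set p | exists q, S (p.1, q) /\ T (q, p.2)].

(** A composite of linear relations is again linear, so it suffices to test generators. Working with
    relations avoids checking that images are well defined. *)
Lemma relcomp_spn D S T P : (forall x y, D x -> D y -> D (x * y)) ->
  P `<=` relcomp (spn D S) (spn D T) ->
  spn D P `<=` relcomp (spn D S) (spn D T).
Proof.
move=> DM PR; apply: spn_min.
  by exists 0; split; exact: spn0.
move=> a [x y] [u v] Da /PR[/= q [Sq Tq]] [/= r [Sr Tr]].
by exists (a *: q + r); split;
  [apply: (@spn_add _ _ _ _ (a *: (x, q)) (u, r)) => //; exact: spn_scale
  |apply: (@spn_add _ _ _ _ (a *: (q, y)) (r, v)) => //; exact: spn_scale].
Qed.

Lemma relcomp_sub S S' T T' : S `<=` S' -> T `<=` T' ->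
  relcomp S T `<=` relcomp S' T'.
Proof. by move=> SS TT p [q [? ?]]; exists q; split; [exact: SS|exact: TT]. Qed.

End Pairs.

(** * Convergence of sequences in epsilon form *)

Section SequenceLimits.
Variables (R : realType) (V : normedModType R).

Lemma seq_cvgP (u : nat -> V) (l : V) :
  u @ \oo --> l <->
  forall eps : R, 0 < eps -> exists N, forall n, (N <= n)%N -> `|l - u n| <= eps.
Proof.
rewrite cvgrPdist_le; split=> H eps eps0.
  by have [N _ HN] := H eps eps0; exists N => n Nn; exact: HN.
by have [N HN] := H eps eps0; exists N => // n /= Nn; exact: HN.
Qed.

End SequenceLimits.

Lemma cauchy_seq_cvg (R : realType) (V : completeNormedModType R) (u : nat -> V) :
  (forall eps : R, 0 < eps ->
     exists N, forall m n, (N <= m)%N -> (N <= n)%N -> `|u m - u n| <= eps) ->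
  exists l : V, u @ \oo --> l.
Proof.
move=> H; suff : cvg (u @ \oo) by move=> c; exists (lim (u @ \oo)).
apply/cauchy_cvgP/cauchy_ballP => eps eps0.
have [N HN] := H (eps / 2) ltac:(by rewrite divr_gt0).
near_simpl; exists ([set n | (N <= n)%N], [set n | (N <= n)%N]); first by split; exists N.
move=> [m n] /= [Nm Nn]; rewrite -ball_normE /=.
by apply: le_lt_trans (HN _ _ Nm Nn) _; rewrite ltr_pdivrMr // ltr_pMr // ltr1n.
Qed.

Lemma half_pow_small (R : realType) (eps : R) : 0 < eps ->
  exists i : nat, 2^-1 ^+ i <= eps.
Proof.
move=> eps0; exists (Num.bound eps^-1); rewrite exprVn invf_ple ?posrE ?exprn_gt0 //.
apply/ltW/(lt_le_trans (archi_boundP _)); first by rewrite invr_ge0 ltW.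
by rewrite -natrX ler_nat ltnW // ltn_expl.
Qed.

(** * Coordinates in a Schauder basis and the basis constant *)

Section Basis.
Variables (R : realType) (V : completeNormedModType R) (e : nat -> V).
Hypothesis he : schauder_basis e.

Let co_spec (x : V) : {a : nat -> R | basis_expansion e x a}.
Proof. by apply: cid; have [a [Ha _]] := he x; exists a. Qed.

Definition co (x : V) : nat -> R := sval (co_spec x).

Lemma coP x : basis_expansion e x (co x).
Proof. by rewrite /co; case: (co_spec x). Qed.

Arguments coP : clear implicits.

Lemma co_uniq x a : basis_expansion e x a -> a = co x.
Proof.
move=> Ha; have [b [_ Hb]] := he x.
by rewrite -(Hb _ Ha) -(Hb _ (coP x)).
Qed.

Lemma suppE x n : supp e x n <-> co x n != 0.
Proof.
split=> [[a [/co_uniq ->]] //|H]; by exists (co x); split => //; exact: coP.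
Qed.

Lemma co_lin a x y : co (a *: x + y) = fun n => a * co x n + co y n.
Proof.
apply/esym/co_uniq; rewrite /basis_expansion.
have -> : (fun N => \sum_(i < N) (a * co x i + co y i) *: e i) =
   (fun N => a *: (\sum_(i < N) co x i *: e i) + \sum_(i < N) co y i *: e i).
  apply/funext => N; rewrite scaler_sumr -big_split /=.
  by apply: eq_bigr => i _; rewrite scalerDl scalerA.
by apply: cvgD; [apply: cvgZr; exact: coP|exact: coP].
Qed.

Lemma co0 n : co 0 n = 0.
Proof.
suff <- : (fun=> 0) = co 0 by [].
apply: co_uniq; rewrite /basis_expansion.
have -> : (fun N => \sum_(i < N) (0 : R) *: e i) = (fun=> 0).
  by apply/funext => N; rewrite big1 // => i _; rewrite scale0r.
exact: cvg_cst.
Qed.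

Lemma co_eq0 x : (forall n, co x n = 0) -> x = 0.
Proof.
move=> H; have := coP x; rewrite /basis_expansion.
have -> : (fun N => \sum_(i < N) co x i *: e i) = (fun=> 0).
  by apply/funext => N; rewrite big1 // => i _; rewrite H scale0r.
by move=> H1; apply: (cvg_unique _ H1 (cvg_cst _)); exact: norm_hausdorff.
Qed.

Lemma co_basis i n : co (e i) n = (n == i)%:R.
Proof.
suff -> : co (e i) = fun n => (n == i)%:R by [].
apply/esym/co_uniq/seq_cvgP => eps eps0; exists i.+1 => N iN.
rewrite (bigD1 (Ordinal iN)) //= eqxx scale1r big1 ?addr0 ?subrr ?normr0 ?ltW //.
by move=> j; rewrite -val_eqE /= => /negPf ->; rewrite scale0r.
Qed.

Lemma basis_neq0 i : e i != 0.
Proof.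
apply/eqP => H; have := co_basis i i.
by rewrite H co0 eqxx => /esym/eqP; rewrite oner_eq0.
Qed.

Definition proj n x : V := \sum_(k < n) co x k *: e k.

Lemma proj_lin n a x y : proj n (a *: x + y) = a *: proj n x + proj n y.
Proof.
rewrite /proj co_lin scaler_sumr -big_split /=.
by apply: eq_bigr => i _; rewrite scalerDl scalerA.
Qed.

Lemma proj0 n : proj n 0 = 0.
Proof. by rewrite /proj big1 // => i _; rewrite co0 scale0r. Qed.

Lemma projZ n a x : proj n (a *: x) = a *: proj n x.
Proof. by rewrite -[a *: x]addr0 proj_lin proj0 addr0. Qed.

Lemma projD n x y : proj n (x + y) = proj n x + proj n y.
Proof. by rewrite -[x in LHS]scale1r proj_lin scale1r. Qed.

Lemma projB n x y : proj n (x - y) = proj n x - proj n y.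
Proof. by rewrite -scaleN1r addrC proj_lin scaleN1r addrC. Qed.

Lemma proj_cvg x : (fun n => proj n x) @ \oo --> x.
Proof. exact: coP. Qed.

(* By Baire some set [forall n, |proj n y| <= k] is somewhere dense; translating
   and scaling makes it dense near every x, with a bound proportional to |x|. *)
Lemma proj_almost_bounded : exists2 M : R, 0 < M &
  forall x eps, 0 < eps ->
    exists y, `|x - y| <= eps /\ forall n, `|proj n y| <= M * `|x|.
Proof.
pose B (k : nat) := [set x : V | forall n, `|proj n x| <= k%:R].
have Bcover x : exists k, B k x.
  have : cvg ((fun n => proj n x) @ \oo) by apply/cvg_ex; exists x; exact: proj_cvg.
  move=> /cvg_seq_bounded [M [Mr HM]].
  exists (Num.bound (`|M| + 1)) => n.
  apply: (@le_trans _ _ (`|M| + 1)); last by apply/ltW/archi_boundP; exact: addr_ge0.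
  by apply: HM => //; apply: le_lt_trans (ler_norm _) _; rewrite ltrDl.
have [k [x0 [r r0 Hr]]] : exists k, exists x0 : V, exists2 r : R, 0 < r &
    ball x0 r `<=` closure (B k).
  apply: contrapT => H.
  have odF i : open (~` closure (B i)) /\ dense (~` closure (B i)).
    split; first by apply: closed_openC; exact: closed_closure.
    apply: contrapT => /denseNE[U [[x [openU Ux]] U0]].
    apply: H.
    have /nbhs_ballP [r /= r0 Hr] : nbhs x U by apply: open_nbhs_nbhs; split.
    exists i, x, r; first by []. move=> y /Hr Uy; apply: contrapT => yB.
    by have : (U `&` ~` closure (B i)) y by []; rewrite U0.
  have : dense (\bigcap_i ~` closure (B i)) by exact: Baire.
  move=> /(_ setT) [] //; first by exists 0.
    exact: openT.
  move=> x [_ Hx]; have [k Bk] := Bcover x.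
  by have /(_ I) := Hx k; apply; exact: subset_closure.
have r'0 : 0 < r / 2 by rewrite divr_gt0.
exists (2 * k.+1%:R / (r / 2)).
  by rewrite divr_gt0 // mulr_gt0.
move=> x eps eps0; case: (eqVneq x 0) => [->|x_neq0].
  exists 0; rewrite subrr normr0 ltW //; split => // n; by rewrite proj0 normr0 mulr0.
have nx0 : 0 < `|x| by rewrite normr_gt0.
(* Scaling by [c] brings [x] to length [r / 2], so [x0] and [x0 + c *: x] both lie in the ball where
   [B k] is dense; [x] is then approximated by a rescaled difference of two elements of [B k]. *)
pose c := (r / 2) / `|x|; have c0 : 0 < c by rewrite divr_gt0.
have near z : `|z - x0| < r -> exists y, B k y /\ `|z - y| < c * eps / 2.
  move=> zr; have /(_ (ball z (c * eps / 2))) [] : closure (B k) z.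
    by apply: Hr; rewrite -ball_normE /= distrC.
  - by apply: nbhsx_ballx; rewrite divr_gt0 // mulr_gt0.
  - by move=> y [By]; rewrite -ball_normE /= => ?; exists y.
have [y1 [By1 Hy1]] : exists y, B k y /\ `|(x0 + c *: x) - y| < c * eps / 2.
  apply: near; rewrite addrAC subrr add0r normrZ gtr0_norm // /c.
  by rewrite divfK ?gt_eqF // gtr_pMr // invf_lt1 ?ltr1n.
have [y0 [By0 Hy0]] : exists y, B k y /\ `|x0 - y| < c * eps / 2.
  by apply: near; rewrite subrr normr0.
exists (c^-1 *: (y1 - y0)); split=> [|n].
  have -> : x - c^-1 *: (y1 - y0) = c^-1 *: ((x0 + c *: x - y1) - (x0 - y0)).
    rewrite (_ : x0 + c *: x - y1 - (x0 - y0) = c *: x - (y1 - y0)).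
      by rewrite [RHS]scalerBr scalerA mulVf ?gt_eqF // scale1r.
    by rewrite !opprB [LHS]addrC !addrA subrK [c *: x + y0]addrC.
  rewrite normrZ gtr0_norm ?invr_gt0 // mulrC ler_pdivrMr //.
  apply: le_trans (ler_normB _ _) _; rewrite mulrC -[leRHS]mulr1.
  apply: le_trans (lerD (ltW Hy1) (ltW Hy0)) _; lra.
rewrite projZ projB normrZ gtr0_norm ?invr_gt0 //.
have -> : 2 * k.+1%:R / (r / 2) * `|x| = c^-1 * (2 * k.+1%:R).
  by rewrite /c; field; rewrite !gt_eqF.
rewrite ler_pM2l ?invr_gt0 //; apply: le_trans (ler_normB _ _) _.
apply: le_trans (lerD (By1 n) (By0 n)) _.
by rewrite -natr1; lra.
Qed.

Arguments proj_cvg : clear implicits.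

(** Successive approximation, as for the open mapping theorem: [x] is the sum of a series of vectors
    with well-bounded projections and geometrically decreasing bounds. The coefficients of its
    partial sums converge to an expansion of [x], which is the expansion of [x] by uniqueness. *)
Theorem basis_constant : exists2 C : R, 0 < C & forall n x, `|proj n x| <= C * `|x|.
Proof.
have [M M0 HM] := proj_almost_bounded.
exists (2 * M); first exact: mulr_gt0.
suff main x : x != 0 -> forall n, `|proj n x| <= 2 * M * `|x|.
  move=> n x; have [->|x0] := eqVneq x 0; last exact: main.
  by rewrite proj0 !normr0 mulr0.
rewrite -normr_gt0; set d := `|x| => d0.
pose h i : R := 2^-1 ^+ i.
have h_gt0 i : 0 < h i by rewrite exprn_gt0 // invr_gt0.
have hS i : h i = 2 * h i.+1 by rewrite /h exprS mulrA divff ?mul1r.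
have dh0 i : 0 < d * h i by rewrite mulr_gt0.
pose y i (v : V) : V := sval (cid (HM v _ (dh0 i.+1))).
have yP i v : `|v - y i v| <= d * h i.+1 /\ forall n, `|proj n (y i v)| <= M * `|v|.
  by rewrite /y; case: cid.
pose r := fix r i := if i is j.+1 then r j - y j (r j) else x.
have rb i : `|r i| <= d * h i.
  by case: i => [|i] /=; [rewrite /h expr0 mulr1|exact: (yP i (r i)).1].
pose z i := x - r i.
have zS i : z i.+1 = z i + y i (r i) by rewrite /z /= opprB addrCA addrC.
have step n i k : `|proj n (z (k + i)%N) - proj n (z i)| <= 2 * M * d * (h i - h (k + i)%N).
  elim: k => [|k IH]; first by rewrite !subrr normr0 mulr0.
  rewrite addSn zS projD addrAC.
  apply: le_trans (ler_normD _ _) _; apply: le_trans (lerD IH ((yP _ _).2 _)) _.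
  apply: (@le_trans _ _ (2 * M * d * (h i - h (k + i)%N) + M * (d * h (k + i)%N))).
    by rewrite lerD2l ler_pM2l.
  by rewrite (hS (k + i)%N); lra.
have Md0 : 0 < 2 * M * d by rewrite !mulr_gt0.
have step' n i j : (i <= j)%N -> `|proj n (z j) - proj n (z i)| <= 2 * M * d * h i.
  move=> ij; rewrite -(subnK ij); apply: le_trans (step _ _ _) _.
  by rewrite ler_pM2l // lerBlDr lerDl ltW.
have small eps : 0 < eps -> exists i, 2 * M * d * h i <= eps /\ d * h i <= eps.
  move=> eps0; have [i Hi] := half_pow_small (divr_gt0 eps0 (addr_gt0 Md0 d0)).
  exists i; move: Hi; rewrite -/(h i) ler_pdivlMr ?addr_gt0 // => Hi.
  by split; apply: le_trans Hi; rewrite mulrC ler_pM2l // ?lerDl ?lerDr ltW.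
have coE v k : co v k *: e k = proj k.+1 v - proj k v.
  by rewrite /proj big_ord_recr /= addrAC subrr add0r.
have co_cvg k : exists l : R, (fun i => co (z i) k) @ \oo --> l.
  apply: cauchy_seq_cvg => eps eps0.
  have ek : 0 < `|e k| by rewrite normr_gt0 basis_neq0.
  have [i [Hi _]] := small (eps * `|e k| / 4) ltac:(by rewrite divr_gt0 // mulr_gt0).
  exists i => m n im jn.
  rewrite -(ler_pM2r ek) -normrZ scalerBl !coE.
  have -> : proj k.+1 (z m) - proj k (z m) - (proj k.+1 (z n) - proj k (z n)) =
    (proj k.+1 (z m) - proj k.+1 (z n)) - (proj k (z m) - proj k (z n)).
    by rewrite !opprB addrACA [RHS]addrACA [- proj k.+1 (z n) - _]addrC.
  have close l : `|proj l (z m) - proj l (z n)| <= eps * `|e k| / 4 + eps * `|e k| / 4.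
    apply: le_trans (ler_distD (proj l (z i)) _ _) _; rewrite [X in _ + X]distrC.
    by apply: lerD; apply: le_trans (step' _ _ _ _) Hi.
  by apply: le_trans (ler_normB _ _) _; have := close k; have := close k.+1; lra.
pose a k := sval (cid (co_cvg k)).
have aP k : (fun i => co (z i) k) @ \oo --> a k by rewrite /a; case: cid.
have sum_cvg n : (fun i => proj n (z i)) @ \oo --> \sum_(k < n) a k *: e k.
  rewrite /proj; elim: n => [|n IH].
    under eq_fun do rewrite big_ord0.
    rewrite big_ord0; exact: cvg_cst.
  under eq_fun do rewrite big_ord_recr /=.
  by rewrite big_ord_recr /=; apply: cvgD => //; apply: cvgZl; exact: aP.
(* Uniformity in [n] is what allows the limits in [n] and in [i] to be exchanged below. *)
have sum_close n i : `|\sum_(k < n) a k *: e k - proj n (z i)| <= 2 * M * d * h i.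
  apply/ler_addgt0Pr => eps eps0.
  have [N HN] := (seq_cvgP _ _).1 (sum_cvg n) _ eps0.
  apply: le_trans (ler_distD (proj n (z (maxn N i))) _ _) _.
  by rewrite addrC; apply: lerD; [exact: step' (leq_maxr _ _)|exact: HN (leq_maxl _ _)].
have -> : proj = fun n v => \sum_(k < n) co v k *: e k by [].
suff -> : co x = a.
  (* At [i = 0] the partial sum [z 0] vanishes, which leaves the bound sought. *)
  move=> n; have := sum_close n 0%N.
  by rewrite /z /= subrr proj0 subr0 /h expr0 mulr1.
apply/esym/co_uniq/seq_cvgP => eps eps0.
have [i [Hi1 Hi2]] := small (eps / 3) ltac:(by rewrite divr_gt0).
have [N HN] := (seq_cvgP _ _).1 (proj_cvg (z i)) (eps / 3) ltac:(by rewrite divr_gt0).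
exists N => n Nn; have H1 := HN _ Nn; have H2 := sum_close n i.
rewrite distrC in H2.
have -> : x - \sum_(k < n) a k *: e k =
   r i + (z i - proj n (z i)) + (proj n (z i) - \sum_(k < n) a k *: e k).
  have -> : x = r i + z i by rewrite /z addrC subrK.
  by move: (z i) (r i) => zi ri; rewrite !addrA subrK.
apply: le_trans (ler_normD _ _) _.
apply: le_trans (lerD (ler_normD _ _) H2) _.
have := rb i; lra.
Qed.

End Basis.

(** * Block sequences, their tails, and diagonalisation *)

Section Blocks.
Variables (R : realType) (V : completeNormedModType R) (e : nat -> V) (F : set R).
Hypothesis he : schauder_basis e.
Hypothesis hF : is_subfield F.

Local Notation co := (co he).
Local Notation proj := (proj he).

Lemma F0 : F 0. Proof. by case: hF. Qed.
Lemma F1 : F 1. Proof. by case: hF. Qed.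
Lemma FM x y : F x -> F y -> F (x * y). Proof. by case: hF => _ _ _ + _; apply. Qed.
Lemma FB x y : F x -> F y -> F (x - y). Proof. by case: hF => _ _ + _ _; apply. Qed.
Lemma FD x y : F x -> F y -> F (x + y).
Proof. by move=> Fx Fy; rewrite -[y]opprK -[- y]sub0r; apply: FB => //; apply: FB => //; exact: F0. Qed.
Lemma FV x : F x -> x != 0 -> F x^-1. Proof. by case: hF => _ _ _ _; apply. Qed.

Lemma fspan_onE (x : nat -> V) P : fspan_on F x P = spn F (x @` P).
Proof.
apply/seteqP; split=> v.
  move=> [k [b [Fb [bP ->]]]]; apply: spn_sum => j jk.
  have [->|bj] := eqVneq (b j) 0; first by rewrite scale0r; exact: spn0.
  rewrite -[_ *: _]addr0; apply: spn_cons => //; last exact: spn0.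
  by exists j => //; exact: bP.
move=> /(spn_seqE F0 FD) [k [b [Fb [bP ->]]]].
by exists k, b; split => //; split => // j jk /bP [].
Qed.

Lemma fspanE (x : nat -> V) : fspan F x = spn F (range x).
Proof. by rewrite /fspan fspan_onE. Qed.

Lemma inWE v : inW e F v <-> spn F (range e) v.
Proof.
split=> [[m [a [Fa ->]]]|/(spn_seqE F0 FD) [k [b [Fb [_ ->]]]]].
  apply: spn_sum => j jm; rewrite -[_ *: _]addr0.
  by apply: spn_cons => //; exact: spn0.
by exists k, b.
Qed.

Lemma spn_inW A v : A `<=` inW e F -> spn F A v -> inW e F v.
Proof. by move=> AW H; apply/inWE; apply: spn_trans H; [exact: FM|move=> w /AW/inWE]. Qed.

Definition supp_lt N (v : V) := forall k, (N <= k)%N -> co v k = 0.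
Definition supp_ge N (v : V) := forall k, (k < N)%N -> co v k = 0.

Lemma spn_supp_lt D (A : set V) N : A `<=` supp_lt N -> spn D A `<=` supp_lt N.
Proof.
move=> AN; apply: spn_min => [k _|a x v _ /AN Hx Hv k Nk]; first exact: co0.
by rewrite co_lin Hx // Hv // mulr0 addr0.
Qed.

Lemma spn_supp_ge D (A : set V) N : A `<=` supp_ge N -> spn D A `<=` supp_ge N.
Proof.
move=> AN; apply: spn_min => [k _|a x v _ /AN Hx Hv k Nk]; first exact: co0.
by rewrite co_lin Hx // Hv // mulr0 addr0.
Qed.

Lemma inW_supp_lt v : inW e F v -> exists N, supp_lt N v.
Proof.
move=> /inWE; elim=> [|a _ w _ [i _ <-] _ [N HN]]; first by exists 0%N => k _; exact: co0.
exists (maxn i.+1 N) => k; rewrite geq_max => /andP[ik Nk].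
by rewrite co_lin co_basis gtn_eqF // mulr0 add0r HN.
Qed.

Lemma proj_id N v : supp_lt N v -> proj N v = v.
Proof.
move=> Hv; have H := @proj_cvg R V e he v.
apply: (cvg_unique _ _ H); first exact: norm_hausdorff.
apply/seq_cvgP => eps eps0; exists N => n Nn.
suff -> : proj N v = proj n v by rewrite subrr normr0 ltW.
rewrite /proj -!(big_mkord xpredT (fun k => co v k *: e k)) [RHS](big_cat_nat (leq0n N) Nn) //=.
rewrite [X in _ = _ + X]big_nat [X in _ = _ + X]big1 ?addr0 // => k /andP[Nk _].
by rewrite Hv // scale0r.
Qed.

Lemma proj_eq0 N v : supp_ge N v -> proj N v = 0.
Proof. by move=> Hv; rewrite /proj big1 // => k _; rewrite Hv // scale0r. Qed.

Lemma supp_lt_ge N v : supp_lt N v -> supp_ge N v -> v = 0.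
Proof. by move=> H1 H2; rewrite -(proj_id H1) proj_eq0. Qed.

(** Adjacent windows for the supports turn comparisons of supports into comparisons of indices. *)
Definition cuts (x : nat -> V) (c : nat -> nat) :=
  (forall n, (c n < c n.+1)%N) /\
  (forall n, supp_ge (c n) (x n) /\ supp_lt (c n.+1) (x n)).

(** Take for [c n] the least index in the support of [x n]. *)
Lemma block_cuts x : block_seq e F x -> exists c, cuts x c.
Proof.
move=> [xW xlt].
have ex n : exists k, co (x n) k != 0.
  apply: contrapT => H; have /eqP := (xW n).2; apply.
  by apply: (co_eq0 (he := he)) => k; apply/eqP; apply: contrapT => /negP Hk; apply: H; exists k.
pose c n := ex_minn (ex n).
have cP n : co (x n) (c n) != 0 by rewrite /c; case: ex_minnP.
have cM n k : co (x n) k != 0 -> (c n <= k)%N by rewrite /c; case: ex_minnP => m _; apply.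
have lt n i j : co (x n) i != 0 -> co (x n.+1) j != 0 -> (i < j)%N.
  by move=> Hi Hj; apply: (xlt n); apply/suppE.
exists c; split=> n; first exact: (lt n).
split=> k Hk; apply/eqP; apply: contrapT => /negP.
  by move=> /cM; rewrite leqNgt Hk.
by move=> /lt/(_ (cP n.+1)); rewrite ltnNge Hk.
Qed.

Lemma cuts_mono x c m n : cuts x c -> (m <= n)%N -> (c m <= c n)%N.
Proof. by move=> [H _]; apply: (@homo_leq _ c leq leqnn leq_trans) => i; exact/ltnW. Qed.

Lemma cuts_ge x c n : cuts x c -> (n <= c n)%N.
Proof. by move=> [H _]; elim: n => [//|n IH]; exact: leq_ltn_trans (H n). Qed.

Lemma cuts_supp_ge x c n j : cuts x c -> (n <= j)%N -> supp_ge (c n) (x j).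
Proof.
move=> cx nj k kc; apply: (cx.2 j).1; apply: leq_trans kc _.
exact: cuts_mono cx nj.
Qed.

Lemma cuts_supp_lt x c n j : cuts x c -> (j < n)%N -> supp_lt (c n) (x j).
Proof.
move=> cx nj k kc; apply: (cx.2 j).2; apply: leq_trans kc.
exact: cuts_mono cx nj.
Qed.

Lemma blk_ltP N x y : supp_lt N x -> supp_ge N y -> blk_lt e x y.
Proof.
move=> Hx Hy i j /(suppE he) Hi /(suppE he) Hj.
apply: (@leq_trans N); first by rewrite ltnNge; apply: contraNN Hi => /Hx ->.
by rewrite leqNgt; apply: contraNN Hj => /Hy ->.
Qed.

Definition tl (x : nat -> V) n := spn F (x @` [set j | (n <= j)%N]).

Definition le_blk (x y : nat -> V) := forall j, spn F (range y) (x j).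

(** Inclusion up to finitely many terms: a diagonal sequence lies below each sequence it is drawn
    from only in this sense. *)
Definition le_tail (x y : nat -> V) :=
  exists m, forall j, (m <= j)%N -> spn F (range y) (x j).

Lemma le_blk_span x y : le_blk x y -> spn F (range x) `<=` spn F (range y).
Proof. by move=> xy; apply: spn_trans; [exact: FM|move=> _ [j _ <-]]. Qed.

Lemma le_blk_refl x : le_blk x x.
Proof. by move=> j; apply: spn_mem; [exact: F1|exists j]. Qed.

Lemma le_blk_trans x y z : le_blk x y -> le_blk y z -> le_blk x z.
Proof. by move=> xy yz j; exact: (le_blk_span yz). Qed.

Lemma le_blk_tail x y : le_blk x y -> le_tail x y.
Proof. by move=> H; exists 0%N. Qed.

Lemma tl_span x n : tl x n `<=` spn F (range x).
Proof. by apply: spn_sub => _ [j _ <-]; exists j. Qed.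

Lemma tl_mono x m n : (m <= n)%N -> tl x n `<=` tl x m.
Proof. by move=> mn; apply: spn_sub => _ [j /= nj <-]; exists j => //=; exact: leq_trans nj. Qed.

Lemma block_inW x : block_seq e F x -> spn F (range x) `<=` inW e F.
Proof. by move=> [xW _] v; apply: spn_inW => _ [j _ <-]; case: (xW j). Qed.

(** Write [v] as a combination of blocks before [n] plus one of the later blocks. The first part is
    supported both below and above [c n], hence is zero. *)
Lemma tl_supp_ge x c n v : cuts x c -> spn F (range x) v -> supp_ge (c n) v -> tl x n v.
Proof.
move=> cx Hv vn.
have [p [q [Hp Hq vE]]] : exists p q,
    [/\ spn F (x @` [set j | (j < n)%N]) p, tl x n q & v = p + q].
  elim: Hv {vn} => [|a _ w Fa [j _ <-] _ [p [q [Hp Hq ->]]]].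
    by exists 0, 0; split; rewrite ?addr0 //; exact: spn0.
  have [jn|nj] := ltnP j n.
    by exists (a *: x j + p), q; split; rewrite ?addrA //; apply: spn_cons => //; exists j.
  exists p, (a *: x j + q); split; rewrite 1?addrCA //.
  by apply: spn_cons => //; exists j.
suff p0 : p = 0 by rewrite vE p0 add0r.
apply: (@supp_lt_ge (c n)).
  by apply: spn_supp_lt Hp => _ [j /= jn <-]; exact: cuts_supp_lt jn.
have qn : supp_ge (c n) q.
  by apply: spn_supp_ge Hq => _ [j /= jn <-]; exact: cuts_supp_ge jn.
have -> : p = (-1) *: q + v by rewrite vE scaleN1r addrC addrK.
by move=> k kn; rewrite co_lin vn // qn // mulr0 addr0.
Qed.

(** For [j >= d n] the support of [x j] starts beyond [d n], because [c j >= j]; the previous lemma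
    then applies. *)
Lemma le_tail_tl x y : block_seq e F x -> block_seq e F y -> le_tail x y ->
  forall n, exists m, tl x m `<=` tl y n.
Proof.
move=> /block_cuts[c cx] /block_cuts[d dy] [m0 H] n.
exists (maxn m0 (d n)); apply: spn_trans; first exact: FM.
move=> _ [j /= + <-]; rewrite geq_max => /andP[mj dj].
apply: (tl_supp_ge dy); first exact: H.
move=> k kd; apply: (cx.2 j).1; apply: leq_trans kd _.
by apply: leq_trans dj _; exact: cuts_ge cx.
Qed.

Lemma le_tail_trans x y z : block_seq e F x -> block_seq e F y ->
  le_tail x y -> le_tail y z -> le_tail x z.
Proof.
move=> bx by_ xy [m Hm]; have [n Hn] := le_tail_tl bx by_ xy m.
exists n => j nj.
have : tl y m (x j) by apply: Hn; apply: spn_mem; [exact: F1|exists j].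
by apply: spn_trans; [exact: FM|move=> _ [i /= mi <-]; exact: Hm].
Qed.

Definition shift (x : nat -> V) m := fun j => x (m + j)%N.

Lemma block_shift x m : block_seq e F x -> block_seq e F (shift x m).
Proof. by move=> [xW xlt]; split=> n; [exact: xW|rewrite /shift addnS; exact: xlt]. Qed.

Lemma shift_le x m : le_blk (shift x m) x.
Proof. by move=> j; exact: le_blk_refl. Qed.

Lemma le_tail_shift x y : le_tail x y -> exists m, le_blk (shift x m) y.
Proof. by move=> [m H]; exists m => j; apply: H; exact: leq_addr. Qed.

Lemma block_far x N : block_seq e F x -> exists j, supp_ge N (x j).
Proof.
move=> /block_cuts[c cx]; exists N => k kN; apply: (cx.2 N).1.
by apply: leq_trans kN _; exact: cuts_ge cx.
Qed.

(** Build a decreasing chain [X i] whose successive members satisfy the conditions, and pick one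
    block from each. The diagonal sequence is eventually in every [X i.+1], so it inherits condition
    [i]. *)
Lemma block_fusion_nat (D : nat -> (nat -> V) -> Prop) :
  (forall i x y, block_seq e F x -> block_seq e F y -> le_tail x y -> D i y -> D i x) ->
  (forall i x, block_seq e F x -> exists y, [/\ block_seq e F y, le_blk y x & D i y]) ->
  forall x, block_seq e F x -> exists y, [/\ block_seq e F y, le_blk y x & forall i, D i y].
Proof.
move=> Dmono Ddense x bx.
have /choice[f fP] (i_x : nat * {x | block_seq e F x}) :
    exists y : {x | block_seq e F x}, le_blk (sval y) (sval i_x.2) /\ D i_x.1 (sval y).
  case: i_x => i [z bz] /=; have [y [by_ yz Dy]] := Ddense i z bz.
  by exists (exist _ y by_).
pose X := fix X i := if i is j.+1 then f (j, X j) else exist _ x bx.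
have XS i : le_blk (sval (X i.+1)) (sval (X i)) /\ D i (sval (X i.+1)) := fP (i, X i).
have Xle i k : le_blk (sval (X (k + i)%N)) (sval (X i)).
  elim: k => [|k IH]; first exact: le_blk_refl.
  by rewrite addSn; apply: le_blk_trans IH; exact: (XS _).1.
have /choice[g gP] (i_N : nat * nat) : exists j, supp_ge i_N.2 (sval (X i_N.1) j).
  by apply: block_far; exact: (svalP (X _)).
have XW i j : inW e F (sval (X i) j) by have [H _] := svalP (X i); case: (H j).
have /choice[h hP] (i_j : nat * nat) : exists N, supp_lt N (sval (X i_j.1) i_j.2).
  exact: inW_supp_lt.
(* [J] selects in each [X k.+1] a block supported beyond the block selected in [X k]. *)
pose J := fix J i := if i is k.+1 then g (k.+1, h (k, J k)) else 0%N.
pose y i := sval (X i) (J i).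
have yX i k : spn F (range (sval (X i))) (y (k + i)%N) by exact: Xle.
have by_ : block_seq e F y.
  split=> n; first by have [H _] := svalP (X n); exact: H.
  by apply: (@blk_ltP (h (n, J n))); [exact: (hP (n, J n))|exact: (gP (n.+1, h (n, J n)))].
exists y; split => // [j|i]; first by have := yX 0%N j; rewrite addn0.
apply: (Dmono i _ (sval (X i.+1))) => //; first exact: (svalP (X _)).
  by exists i.+1 => j ij; rewrite -(subnK ij); exact: yX.
exact: (XS i).2.
Qed.

Lemma block_fusion (I : countType) (D : I -> (nat -> V) -> Prop) :
  (forall i x y, block_seq e F x -> block_seq e F y -> le_tail x y -> D i y -> D i x) ->
  (forall i x, block_seq e F x -> exists y, [/\ block_seq e F y, le_blk y x & D i y]) ->
  forall x, block_seq e F x -> exists y, [/\ block_seq e F y, le_blk y x & forall i, D i y].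
Proof.
move=> Dmono Ddense x bx.
pose D' n y := if unpickle n is Some i then D i y else True.
have [||y [by_ yx Dy]] := @block_fusion_nat D' _ _ x bx.
- by move=> n y z by_ bz yz; rewrite /D'; case: unpickle => // i; exact: Dmono.
- move=> n y by_; rewrite /D'; case: unpickle => [i|]; first exact: Ddense.
  by exists y; split => //; exact: le_blk_refl.
- exists y; split => // i; have := Dy (pickle i).
  by rewrite /D' pickleK.
Qed.

End Blocks.

(** * The two games, and the passage from the asymptotic game to the Gowers game *)

Section Games.
Variables (R : realType) (V : completeNormedModType R) (e : nat -> V) (F : set R).

(** Real coefficients make the pairs span the graph of an isomorphism: a vector related to zero must
    be zero. *)
Definition eqv (k : R) (s : seq (V * V)) :=
  forall p, spn setT [set` s] p -> `|p.1| <= k * `|p.2| /\ `|p.2| <= k * `|p.1|.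

(* Player II, having generators [G], answers the vectors [E] with new generators
   [G'] in [T] and, for each vector of [E], an image in the span of [G ++ G']. *)
Definition reply (T : set V) (G E G' : seq V) (t : seq (V * V)) :=
  [/\ [set` G'] `<=` T, map fst t = E & [set` map snd t] `<=` spn F [set` (G ++ G')]].

(* Player II survives [c] more rounds of the asymptotic game from [Y] into the
   tails of [x]. *)
Fixpoint asy (k : R) (c : bord) (Y : set V) (x : nat -> V) (s : seq (V * V)) (G : seq V) :=
  match c with
  | bZ => eqv k s
  | bS c => forall E n, [set` E] `<=` Y ->
      exists G' t, reply (tl F x n) G E G' t /\ asy k c Y x (s ++ t) (G ++ G')
  | bL f => forall n, asy k (f n) Y x s G
  end.

(* The Gowers game: vectors come from a tail of [x] and are sent to arbitrary
   block subspaces. *)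
Fixpoint gow (k : R) (c : bord) (x : nat -> V) (s : seq (V * V)) (G : seq V) : Prop :=
  match c with
  | bZ => eqv k s
  | bS c => exists m, forall E, [set` E] `<=` tl F x m ->
      forall z, block_seq e F z -> le_blk F z x ->
      exists G' t, reply (spn F (range z)) G E G' t /\ gow k c x (s ++ t) (G ++ G')
  | bL f => forall n, gow k (f n) x s G
  end.

Hypothesis he : schauder_basis e.
Hypothesis hF : is_subfield F.
Hypothesis hFc : countable F.

Lemma reply_sub T T' G E G' t : T `<=` T' -> reply T G E G' t -> reply T' G E G' t.
Proof. by move=> TT [? ? ?]; split => //; apply: subset_trans TT. Qed.

Lemma asy_mono k c Y Y' x x' s G :
  Y' `<=` Y -> (forall n', exists n, tl F x n `<=` tl F x' n') ->
  asy k c Y x s G -> asy k c Y' x' s G.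
Proof.
move=> YY xx; elim: c s G => [|c IH|f IH] s G //= H.
  move=> E n' EY; have [n xn] := xx n'.
  have [G' [t [rep Ht]]] := H E n (subset_trans EY YY).
  by exists G', t; split; [exact: reply_sub rep|exact: IH].
by move=> n; exact: IH.
Qed.

Lemma gow_mono k c x y s G : block_seq e F x -> block_seq e F y -> le_tail F x y ->
  gow k c y s G -> gow k c x s G.
Proof.
move=> bx by_ xy; elim: c s G => [|c IH|f IH] s G //=.
  move=> [m Hm]; have [n xn] := le_tail_tl he hF bx by_ xy m.
  exists n => E EY z bz zx.
  have [i zi] : exists i, le_blk F (shift z i) y.
    apply: le_tail_shift; apply: (le_tail_trans he hF bz bx _ xy); exact: le_blk_tail.
  have [G' [t [rep Ht]]] := Hm E (subset_trans EY xn) _ (block_shift i bz) zi.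
  exists G', t; split; last exact: IH.
  by apply: reply_sub rep; apply: le_blk_span => //; exact: shift_le.
by move=> H n; exact: IH.
Qed.

(** Player I may show the empty list until the clock runs out, which leaves [s] unchanged. *)
Lemma asy_eqv k c Y x s G : asy k c Y x s G -> eqv k s.
Proof.
elim: c s G => [|c IH|f IH] s G //=; last by move=> /(_ 0%N)/IH.
by move=> /(_ [::] 0%N)[//|G' [t [[_ + _]]]]; case: t => // _; rewrite cats0 => /IH.
Qed.

Lemma gow_eqv k c x z s G : block_seq e F z -> le_blk F z x -> gow k c x s G -> eqv k s.
Proof.
move=> bz zx; elim: c s G => [|c IH|f IH] s G //=; last by move=> /(_ 0%N)/IH.
move=> [m /(_ [::])] H; have [//|G' [t [[_ + _]]]] := H _ z bz zx.
by case: t => // _; rewrite cats0 => /IH.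
Qed.

Definition asy_below k c s G x :=
  exists y, [/\ block_seq e F y, le_blk F y x & asy k c (spn F (range y)) x s G].

Lemma asy_below_mono k c x y s G : block_seq e F x -> block_seq e F y -> le_tail F x y ->
  asy_below k c s G x -> asy_below k c s G y.
Proof.
move=> bx by_ xy [z [bz zx Hz]].
have [i zi] : exists i, le_blk F (shift z i) y.
  by apply: le_tail_shift; apply: (le_tail_trans he hF bz bx _ xy); exact: le_blk_tail.
exists (shift z i); split => //; first exact: block_shift.
apply: asy_mono Hz; last exact: (le_tail_tl he hF bx by_ xy).
by apply: le_blk_span => //; exact: shift_le.
Qed.

Definition decided k c s G x := asy_below k c s G x -> gow k c x s G.

(** [asy_below] passes to larger sequences and [gow] to smaller ones, so the implication between
    them is hereditary and can be fused. *)
Lemma decided_mono k c s G x y : block_seq e F x -> block_seq e F y -> le_tail F x y ->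
  decided k c s G y -> decided k c s G x.
Proof.
move=> bx by_ xy H Hx; apply: (gow_mono bx by_ xy); apply: H.
exact: asy_below_mono Hx.
Qed.

(** Countability of [F] makes [W] countable, hence also the set of positions of the games. *)
Lemma inW_enum : exists w : nat -> V,
  (forall n, inW e F (w n)) /\ forall v, inW e F v -> exists n, w n = v.
Proof.
have [q [qF qS]] : exists q : nat -> R, (forall n, F (q n)) /\ forall a, F a -> exists n, q n = a.
  have /countable_injP[f finj] := hFc.
  have /choice[q qP] n : exists a, F a /\ ((exists2 b, F b & f b = n) -> f a = n).
    have [[b Fb fb]|H] := pselect (exists2 b, F b & f b = n); first by exists b.
    by exists 0; split => //; exact: F0.
  exists q; split=> [n|a Fa]; first exact: (qP n).1.
  exists (f a); apply: finj; rewrite ?inE //; first exact: (qP _).1.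
  by apply: (qP (f a)).2; exists a.
pose w (s : seq nat) := \sum_(i < size s) q (nth 0%N s i) *: e i.
exists (fun n => if unpickle n is Some s then w s else 0); split=> [n|v [m [a [Fa ->]]]].
  case: unpickle => [s|]; first by exists (size s), (fun i => q (nth 0%N s i)).
  by exists 0%N, (fun=> 0); split; [move=> _; exact: F0|rewrite big_ord0].
have /choice[g gP] n : exists j, q j = a n by exact: qS.
exists (pickle (mkseq g m)); rewrite pickleK /w size_mkseq.
by apply: eq_bigr => i _; rewrite nth_mkseq // gP.
Qed.

(* Fixing [E], every [x] can be shrunk so that either II can answer [E] with a
   winning move in every subspace, or in no subspace at all. *)
Lemma reply_dichotomy (W : seq V -> seq (V * V) -> Prop) G E x : block_seq e F x ->
  exists y, [/\ block_seq e F y, le_blk F y x &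
    (forall z, block_seq e F z -> le_blk F z y ->
       exists G' t, reply (spn F (range z)) G E G' t /\ W G' t) \/
    (exists n, forall G' t, reply (tl F y n) G E G' t -> ~ W G' t)].
Proof.
move=> bx.
have [[z [bz zx Hz]]|H] := pselect (exists z, [/\ block_seq e F z, le_blk F z x &
    ~ exists G' t, reply (spn F (range z)) G E G' t /\ W G' t]).
  exists z; split => //; right; exists 0%N => G' t rep HW; apply: Hz.
  by exists G', t; split => //; apply: reply_sub rep; exact: tl_span.
exists x; split => //; first exact: le_blk_refl.
by left=> z bz zx; apply: contrapT => Hz; apply: H; exists z.
Qed.

Lemma reply_dichotomy_mono (W : seq V -> seq (V * V) -> Prop) G E x y :
  block_seq e F x -> block_seq e F y -> le_tail F x y ->
  (forall z, block_seq e F z -> le_blk F z y ->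
     exists G' t, reply (spn F (range z)) G E G' t /\ W G' t) \/
  (exists n, forall G' t, reply (tl F y n) G E G' t -> ~ W G' t) ->
  (forall z, block_seq e F z -> le_blk F z x ->
     exists G' t, reply (spn F (range z)) G E G' t /\ W G' t) \/
  (exists n, forall G' t, reply (tl F x n) G E G' t -> ~ W G' t).
Proof.
move=> bx by_ xy [H|[n H]]; [left|right].
  move=> z bz zx.
  have [i zi] : exists i, le_blk F (shift z i) y.
    by apply: le_tail_shift; apply: (le_tail_trans he hF bz bx _ xy); exact: le_blk_tail.
  have [G' [t [rep Ht]]] := H _ (block_shift i bz) zi.
  exists G', t; split => //; apply: reply_sub rep.
  by apply: le_blk_span => //; exact: shift_le.
have [m xm] := le_tail_tl he hF bx by_ xy n.
by exists m => G' t rep; apply: H; exact: reply_sub rep.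
Qed.

(** Induction on the clock. At a successor, [x1] decides all continuations by one round, and [x2]
    settles the dichotomy for every list [E]; a winning asymptotic strategy below [x2] excludes the
    bad alternative. At a limit, fuse over the terms of the supremum. *)
Lemma decided_dense k c s G x : [set` G] `<=` inW e F -> block_seq e F x ->
  exists y, [/\ block_seq e F y, le_blk F y x & decided k c s G y].
Proof.
have [w [wW wS]] := inW_enum.
have mapw (E : seq V) : [set` E] `<=` inW e F -> exists i, E = map w i.
  elim: E => [|v E IH] EW; first by exists [::].
  have [i ->] : exists i, E = map w i.
    by apply: IH => u /= uE; apply: EW; rewrite /= inE uE orbT.
  have [n <-] := wS v (EW v (mem_head _ _)).
  by exists (n :: i).
pose w2 (p : nat * nat) := (w p.1, w p.2).
have mapw2 (t : seq (V * V)) : [set` map fst t] `<=` inW e F ->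
    [set` map snd t] `<=` inW e F -> exists i, t = map w2 i.
  elim: t => [|[u v] t IH] t1 t2; first by exists [::].
  have [i ->] : exists i, t = map w2 i.
    by apply: IH => z /= zt; [apply: t1|apply: t2]; rewrite /= inE zt orbT.
  have [m <-] := wS u (t1 u (mem_head _ _)).
  have [n <-] := wS v (t2 v (mem_head _ _)).
  by exists ((m, n) :: i).
elim: c s G x => [|c IH|f IH] s G x GW bx.
- exists x; split => //; first exact: le_blk_refl.
  by move=> [y [_ _]].
- have [x1 [bx1 x1x Hx1]] : exists y, [/\ block_seq e F y, le_blk F y x &
      forall i : seq (nat * nat) * seq nat,
        decided k c (s ++ map w2 i.1) (G ++ map w i.2) y].
    apply: (block_fusion he hF) bx.
      by move=> i y z by_ bz yz; exact: decided_mono.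
    move=> i y by_; apply: IH => // v /=; rewrite mem_cat => /orP[/GW //|].
    by move=> /mapP[j _ ->].
  pose W G' t := gow k c x1 (s ++ t) (G ++ G').
  have [x2 [bx2 x2x1 Hx2]] := block_fusion he hF
    (fun i : seq nat => @reply_dichotomy_mono W G (map w i))
    (fun i : seq nat => @reply_dichotomy W G (map w i)) bx1.
  have [[y [by_ yx2 Hy]]|H] := pselect (asy_below k (bS c) s G x2); last first.
    by exists x2; split => //; exact: le_blk_trans x1x.
  have yx1 := le_blk_trans hF yx2 x2x1.
  exists y; split => //; first exact: le_blk_trans x1x.
  move=> _; exists 0%N => E EY z bz zy.
  have EY' : [set` E] `<=` spn F (range y) by apply: subset_trans EY _; exact: tl_span.
  have EW : [set` E] `<=` inW e F by apply: subset_trans EY' _; exact: block_inW.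
  have [i Ei] := mapw E EW.
  have gowy G' t : W G' t -> gow k c y (s ++ t) (G ++ G').
    by apply: gow_mono => //; exact: le_blk_tail.
  (* In the second case, II's asymptotic answer to [E] in the [n]th tail of [x2] reaches a position
     decided by [x1], hence is a winning reply there, against [Hn]. *)
  have [Hx2E|[n Hn]] := Hx2 i.
    have [|G' [t [rep Ht]]] := Hx2E z bz; first exact: le_blk_trans yx2.
    by exists G', t; split; [rewrite Ei|exact: gowy].
  have [G' [t [rep Ht]]] := Hy E n EY'.
  exfalso; apply: (Hn G' t); first by rewrite -Ei.
  have [G'W tE tG] := rep.
  have G'W' : [set` G'] `<=` inW e F.
    apply: subset_trans G'W _; apply: subset_trans (@tl_span _ _ _ _ _) _.
    exact: block_inW.
  have [j Gj] := mapw G' G'W'.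
  have [l tl_] : exists l, t = map w2 l.
    apply: mapw2; first by rewrite tE.
    move=> v /tG; apply: spn_inW => // u /=; rewrite mem_cat => /orP[/GW //|].
    exact: G'W'.
  rewrite /W Gj tl_; apply: (Hx1 (l, j)).
  apply: (asy_below_mono bx2 bx1); first exact: le_blk_tail.
  by exists y; split => //; rewrite /= -tl_ -Gj.
- have [y [by_ yx Hy]] := block_fusion he hF
    (fun n => @decided_mono k (f n) s G) (fun n y => @IH n s G y GW) bx.
  exists y; split => // -[z [bz zy Hz]] n; apply: Hy.
  by exists z; split => //; exact: Hz.
Qed.

End Games.

(** * Trees of equivalent sequences in terms of linear relations *)

Section Trees.
Variables (R : realType) (V : completeNormedModType R).
Implicit Types (y : nat -> V) (t : seq V).

Definition matching y t : set (V * V) :=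
  (fun i => (y i, nth 0 t i)) @` [set i | (i < size t)%N].

Lemma sum_pair (n : nat) (a : nat -> R) (y z : nat -> V) :
  \sum_(i < n) a i *: ((y i, z i) : V * V) =
  (\sum_(i < n) a i *: y i, \sum_(i < n) a i *: z i).
Proof.
elim: n => [|n IH]; first by rewrite !big_ord0.
by rewrite !big_ord_recr /= IH.
Qed.

(** The real span of the matching consists exactly of the pairs of combinations of the [y i] and of
    [t] with common coefficients. *)
Lemma equivK_matching (K : R) t y : 0 < K ->
  equivK K t y <->
  forall p, spn setT (matching y t) p -> `|p.1| <= K * `|p.2| /\ `|p.2| <= K * `|p.1|.
Proof.
move=> K0; split=> [H p Hp|H a].
  have [a [_ ->]] := spn_fin (D := setT) I (fun _ _ _ _ => I) Hp.
  by rewrite sum_pair /=; have [H1 H2] := H a; split => //; rewrite -ler_pdivrMl.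
have /H : spn setT (matching y t) (\sum_(i < size t) a i *: (y i, nth 0 t i) : V * V).
  apply: (@spn_sum _ _ _ _ _ a (fun i => (y i, nth 0 t i))) => j jt.
  by rewrite -[_ *: _]addr0; apply: spn_cons => //; [exists j|exact: spn0].
by rewrite sum_pair /= => -[H1 H2]; rewrite ler_pdivrMl.
Qed.

Lemma matching_cat y t u : matching y t `<=` matching y (t ++ u).
Proof.
move=> _ [i /= it <-]; exists i; first by rewrite /= size_cat ltn_addr.
by rewrite nth_cat it.
Qed.

(** Every proper extension adds at least one entry, so [q] successor steps are enough to reach
    extensions by [q] entries. *)
Lemma rank_lt_delay (X : Type) (T : seq X -> Prop) b q (t : seq X) :
  (forall u, T (t ++ u) -> (q <= size u)%N -> rank_lt T (t ++ u) b) ->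
  T t -> rank_lt T t (badd_nat b q).
Proof.
elim: q t => [|q IH] t H Tt; first by rewrite -(cats0 t); apply: H; rewrite ?cats0.
move=> u u0 Tu /=; apply: IH => // v Tv qv; rewrite -catA; apply: H; first by rewrite catA.
by rewrite size_cat; case: u u0 {Tu Tv} => //= x u _; rewrite ltnS; exact: leq_trans (leq_addl _ _).
Qed.

End Trees.

(** * Large rank from the composition of two winning strategies *)

Section GowersSide.
Variables (R : realType) (V : completeNormedModType R) (e : nat -> V) (F : set R).
Hypothesis he : schauder_basis e.
Hypothesis hF : is_subfield F.

Lemma relcomp_norm (K L : R) (S T : set (V * V)) : 0 <= K -> 0 <= L ->
  (forall p, S p -> `|p.1| <= K * `|p.2| /\ `|p.2| <= K * `|p.1|) ->
  (forall p, T p -> `|p.1| <= L * `|p.2| /\ `|p.2| <= L * `|p.1|) ->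
  forall p, relcomp S T p -> `|p.1| <= K * L * `|p.2| /\ `|p.2| <= K * L * `|p.1|.
Proof.
move=> K0 L0 HS HT [a b] /= [q [/HS /= [S1 S2] /HT /= [T1 T2]]]; split.
  by apply: le_trans S1 _; rewrite -mulrA ler_wpM2l.
by apply: le_trans T2 _; rewrite [K * L]mulrC -mulrA ler_wpM2l.
Qed.

(* II composes her two strategies: the next vector of [z] is sent by the
   asymptotic game from [y] into the tail of [x] demanded by the Gowers game,
   whose answer then lies in [u]. *)
Lemma compose_strategies (K : R) (c : bord) (x y u z : nat -> V) :
  0 < K -> block_seq e F u -> le_blk F u x ->
  (forall n, spn F (range y) (z n)) ->
  forall t s G s2 H,
    asy F K c (spn F (range y)) x s G -> gow e F K c x s2 H ->
    matching z t `<=` relcomp (spn F [set` s]) (spn F [set` s2]) ->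
    [set` G] `<=` fst @` [set` s2] ->
    [set` map snd s2] `<=` spn F (range u) -> [set` H] `<=` spn F (range u) ->
    ~ rank_lt (Ttree z (fspan F u) (K * K)) t c.
Proof.
move=> K0 bu ux zy; elim: c => [|c IH|f IH] t s G s2 H /=; [by move=> _ _ _ _ _ _ []| |].
  2: by move=> Ha Hg st Gs s2u Hu [n]; exact: (IH n t s G s2 H).
move=> Ha [m Hg] st Gs s2u Hu rk.
(* One round of each game: I shows the next term of [z] asymptotically, and II's new generators [G']
   become the vectors shown in the Gowers game. *)
have [|G' [r [[G'x rz rG] Har]]] := Ha [:: z (size t)] m.
  by move=> v /=; rewrite inE => /eqP ->.
have [G2 [r2 [[G2u r2G' r2H] Hgr]]] := Hg G' G'x u bu ux.
case: r rz rG Har => [//|[z0 w] [|//]] /= [->] rG Har.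
have HG2u : spn F [set` (H ++ G2)] `<=` spn F (range u).
  apply: spn_trans; first exact: FM.
  by move=> v /=; rewrite mem_cat => /orP[/Hu|/G2u].
have s2r2u : [set` map snd (s2 ++ r2)] `<=` spn F (range u).
  move=> v /=; rewrite map_cat mem_cat => /orP[/s2u //|vr].
  by apply: HG2u; exact: r2H.
have GG' : [set` (G ++ G')] `<=` fst @` [set` (s2 ++ r2)].
  move=> v /=; rewrite mem_cat => /orP[/Gs [p /= ps <-]|].
    by exists p => //=; rewrite mem_cat ps.
  by rewrite -r2G' => /mapP[p pr ->]; exists p => //=; rewrite mem_cat pr orbT.
(* The image [w] is a combination of generators, all of which have already been answered in the
   Gowers game; this determines the next entry [v]. *)
have [v Hv] : exists v, spn F [set` (s2 ++ r2)] (w, v).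
  apply: spn_lift; apply: (spn_sub GG'); apply: rG; exact: mem_head.
have st' : matching z (t ++ [:: v]) `<=`
    relcomp (spn F [set` (s ++ [:: (z (size t), w)])]) (spn F [set` (s2 ++ r2)]).
  move=> _ [i /= + <-]; rewrite size_cat addn1 ltnS leq_eqVlt => /orP[/eqP ->|it].
    exists w; rewrite nth_cat ltnn subnn /=; split => //.
    by apply: spn_mem; [exact: F1|rewrite /= mem_cat mem_head orbT].
  rewrite nth_cat it; have /st [q /= [Hq1 Hq2]] : matching z t (z i, nth 0 t i) by exists i.
  by exists q; split; [move: Hq1|move: Hq2]; apply: spn_sub => p /= pin; rewrite mem_cat pin.
apply: (IH (t ++ [:: v]) _ _ _ _ Har Hgr st' GG' s2r2u).
  by move=> a /= aH; apply: HG2u; apply: spn_mem => //; exact: F1.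
apply: rk => //; split.
  move=> i it; rewrite fspanE //.
  have /st' [q /= [_ Hq2]] : matching z (t ++ [:: v]) (z i, nth 0 (t ++ [:: v]) i) by exists i.
  apply: (spn_trans (FM hF) _ (spn_snd Hq2)) => _ [p /= pin <-].
  by apply: s2r2u; apply/mapP; exists p.
apply/equivK_matching; first exact: mulr_gt0.
move=> p Hp; apply: (@relcomp_norm K K (spn setT [set` (s ++ [:: (z (size t), w)])])
  (spn setT [set` (s2 ++ r2)])); rewrite ?ltW //.
- exact: (asy_eqv Har).
- exact: (gow_eqv bu ux Hgr).
apply: (relcomp_spn (D := setT)) Hp => //; apply: subset_trans st' _.
by apply: relcomp_sub; exact: spn_coef.
Qed.

End GowersSide.

(** * Moving the first [l] blocks into a gap, with control of the norm *)

Section Perturbation.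
Variables (R : realType) (V : completeNormedModType R) (e : nat -> V) (F : set R).
Hypothesis he : schauder_basis e.
Variables (x : nat -> V) (c : nat -> nat) (C : R) (l N : nat).
Hypothesis cx : cuts he x c.
Hypothesis x_neq0 : forall j, x j != 0.
Hypothesis C0 : 0 < C.
Hypothesis HC : forall n v, `|proj he n v| <= C * `|v|.
Hypothesis lN : (l <= N)%N.

(** On the span of the blocks this is the component along [x j]; as a difference of basis
    projections it has norm at most [2 * C]. *)
Definition coord j v := proj he (c j.+1) v - proj he (c j) v.

Lemma coord_lin j a u v : coord j (a *: u + v) = a *: coord j u + coord j v.
Proof. by rewrite /coord !proj_lin scalerBr opprD addrACA. Qed.

Lemma coord0 j : coord j 0 = 0.
Proof. by rewrite /coord !proj0 subrr. Qed.

Lemma coordZ j a u : coord j (a *: u) = a *: coord j u.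
Proof. by rewrite -[a *: u]addr0 coord_lin coord0 addr0. Qed.

Lemma coord_block j i : coord j (x i) = (j == i)%:R *: x i.
Proof.
rewrite /coord; have [->|ji] := eqVneq j i.
  rewrite scale1r proj_id ?proj_eq0 ?subr0 //.
    exact: (cuts_supp_ge cx).
  exact: (cuts_supp_lt cx).
rewrite scale0r; case: (ltngtP j i) ji => // ji _.
  by rewrite !proj_eq0 ?subrr //; apply: (cuts_supp_ge cx) => //; exact: ltnW.
by rewrite !proj_id ?subrr //; apply: (cuts_supp_lt cx) => //; exact: ltnW.
Qed.

Lemma coord_bound j v : `|coord j v| <= 2 * C * `|v|.
Proof.
apply: le_trans (ler_normB _ _) _; apply: le_trans (lerD (HC _ _) (HC _ _)) _.
lra.
Qed.

(** Rescaling preserves the norm of each block. The factor is in [F] for blocks of [W], as [F]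
    contains their norms. *)
Definition moved j := (`|x j| / `|x (N + j)%N|) *: x (N + j)%N.

Definition moving : set (V * V) :=
  [set p | (exists2 j, (j < l)%N & p = (x j, moved j)) \/
           (exists2 j, (N + l < j)%N & p = (x j, x j))].

Lemma norm_moved j : `|moved j| = `|x j|.
Proof.
rewrite /moved normrZ ger0_norm; last by rewrite divr_ge0.
by rewrite divfK ?normr_eq0.
Qed.

Lemma coord_moving j p : (j < l)%N -> spn setT moving p ->
  exists a, coord j p.1 = a *: x j /\ coord (N + j)%N p.2 = a *: moved j.
Proof.
move=> jl; move: p; apply: spn_min.
  by exists 0; rewrite !coord0 !scale0r.
move=> a p v _ Hp [b [/= vb1 vb2]]; rewrite /= !coord_lin vb1 vb2.
case: Hp => [[i il ->]|[i Ni ->]] /=.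
  exists (a * (j == i)%:R + b).
  rewrite /moved coordZ !coord_block eqn_add2l !scalerDl.
  by have [->|_] := eqVneq j i; rewrite ?mulr1 ?scale1r ?mulr0 ?scale0r ?scaler0.
exists b; rewrite !coord_block.
have /negPf -> : j != i by apply/eqP; lia.
have /negPf -> : (N + j)%N != i by apply/eqP; lia.
by rewrite !scale0r !scaler0 !add0r.
Qed.

Lemma moving_sub p : spn setT moving p ->
  p.1 - p.2 = \sum_(j < l) (coord j p.1 - coord (N + j)%N p.2).
Proof.
move: p; apply: (spn_min (P := fun p => p.1 - p.2 = _ )).
  by rewrite subrr big1 // => j _; rewrite !coord0 subrr.
move=> a p v _ Hp /= vE; rewrite opprD addrACA -scalerBr vE.
have -> : p.1 - p.2 = \sum_(j < l) (coord j p.1 - coord (N + j)%N p.2).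
  case: Hp => [[i il ->]|[i Ni ->]] /=.
    rewrite (bigD1 (Ordinal il)) //= /moved coordZ !coord_block !eqxx !scale1r.
    rewrite big1 ?addr0 // => j; rewrite -val_eqE /= => ji.
    by rewrite coordZ !coord_block eqn_add2l (negPf ji) !scale0r scaler0 subr0.
  rewrite subrr big1 // => j _; have := ltn_ord j => jl; rewrite !coord_block.
  have /negPf -> : (j : nat) != i by apply/eqP; move: Ni jl lN => /=; lia.
  have /negPf -> : (N + j)%N != i by apply/eqP; lia.
  by rewrite scale0r subrr.
rewrite scaler_sumr -big_split /=; apply: eq_bigr => j _.
by rewrite !coord_lin [in RHS]opprD [RHS]addrACA -scalerBr.
Qed.

(** Related vectors differ only in [l] coordinates on either side, with equal norms in pairs. Each
    has norm at most [2 * C] times that of either vector, whence a difference of at most [4 * C * l]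
    times it. *)
Lemma moving_norm p : spn setT moving p ->
  `|p.1| <= (1 + 4 * C * l%:R) * `|p.2| /\ `|p.2| <= (1 + 4 * C * l%:R) * `|p.1|.
Proof.
move=> Hp.
have dist (d : R) : (forall j, (j < l)%N -> `|coord j p.1| <= d) ->
    `|p.1 - p.2| <= l%:R * (2 * d).
  move=> Hd; rewrite (moving_sub Hp); apply: le_trans (ler_norm_sum _ _ _) _.
  rewrite mulr_natl -[X in _ *+ X](card_ord l) -sumr_const; apply: ler_sum => j _.
  apply: le_trans (ler_normB _ _) _; have [a [H1 H2]] := coord_moving (ltn_ord j) Hp.
  have := Hd j (ltn_ord j); rewrite H2 normrZ norm_moved -normrZ -H1; lra.
have d1 : `|p.1 - p.2| <= l%:R * (2 * (2 * C * `|p.1|)).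
  by apply: dist => j _; exact: coord_bound.
have d2 : `|p.1 - p.2| <= l%:R * (2 * (2 * C * `|p.2|)).
  apply: dist => j jl; have [a [-> H2]] := coord_moving jl Hp.
  by rewrite normrZ -norm_moved -normrZ -H2; exact: coord_bound.
split.
  by have := ler_normD (p.1 - p.2) p.2; rewrite subrK => H; apply: le_trans H _; lra.
by have := ler_normB p.1 (p.1 - p.2); rewrite subKr => H; apply: le_trans H _; lra.
Qed.

End Perturbation.

(** * Winning positions of player I and the lengths of the gaps *)

Section Winning.
Variables (R : realType) (V : completeNormedModType R) (e : nat -> V) (F : set R).

(* [fst_wins k c Y x s G n]: player I has a winning strategy in the asymptotic
   game whose first move demands the [n]th tail. *)
Fixpoint fst_wins (k : R) (c : bord) (Y : set V) (x : nat -> V) (s : seq (V * V))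
    (G : seq V) (n : nat) : Prop :=
  match c with
  | bZ => ~ eqv k s
  | bS c => exists E, [set` E] `<=` Y /\
      forall G' t, reply F (tl F x n) G E G' t -> ~ asy F k c Y x (s ++ t) (G ++ G')
  | bL f => exists i, fst_wins k (f i) Y x s G n
  end.

Lemma fst_winsP k c Y x s G : ~ asy F k c Y x s G -> exists n, fst_wins k c Y x s G n.
Proof.
elim: c s G => [|c _|f IH] s G /=; first by exists 0%N.
  move=> H; apply: contrapT => Hn; apply: H => E n EY; apply: contrapT => Ht.
  apply: Hn; exists n, E; split => // G' t rep Ha; apply: Ht.
  by exists G', t.
move=> /existsNP[i /IH[n Hn]]; by exists n, i.
Qed.

Lemma fst_wins_mono k c Y x s G m n : (m <= n)%N ->
  fst_wins k c Y x s G m -> fst_wins k c Y x s G n.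
Proof.
move=> mn; elim: c s G => [//|c _|f IH] s G /=.
  move=> [E [EY H]]; exists E; split => // G' t rep; apply: H.
  by apply: reply_sub rep; exact: tl_mono.
by move=> [i Hi]; exists i; exact: IH.
Qed.

(** Clocks met during a play are subterms of the initial one; addressing them by paths makes them
    countable. A successor ignores its entry of the path. *)
Fixpoint sub_bord (c : bord) (p : seq nat) : bord :=
  match p, c with
  | [::], _ => c
  | _ :: p, bZ => bZ
  | _ :: p, bS c => sub_bord c p
  | i :: p, bL f => sub_bord (f i) p
  end.

Lemma sub_bord_rcons c p i :
  sub_bord c (rcons p i) =
  match sub_bord c p with bZ => bZ | bS c => c | bL f => f i end.
Proof.
elim: p c => [|j p IH] [|c|f] //=; first by case: c.
by case: (f i).
Qed.

Lemma finite_uniform (T : finType) (P : T -> nat -> Prop) :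
  (forall t m n, (m <= n)%N -> P t m -> P t n) -> (forall t, exists n, P t n) ->
  exists n, forall t, P t n.
Proof.
move=> Pmono /choice[f fP]; exists (\max_t f t) => t.
by apply: Pmono (fP t); exact: leq_bigmax.
Qed.

Definition picked (x : nat -> V) (B : pred nat) l := [seq x j | j <- iota 0 l & B j].

(* Each gap [N m] is long enough for all positions with code at most [m] and all
   sets of generators among the [x j], [j < l m].  The bound [k] on the constant is
   allowed to depend on [l m], which is why the gap is chosen after its left end. *)
Lemma gaps (alpha : bord) (w : nat -> V * V) (Y : set V) (x : nat -> V)
    (kappa : nat -> nat -> nat) :
  exists l N : nat -> nat, [/\ forall m, (l m <= N m)%N,
    forall m, l m.+1 = (N m + l m).+1 &
    forall m k (i : seq nat * seq nat) B, (k <= kappa (l m) m)%N -> (pickle i <= m)%N ->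
      ~ asy F k%:R (sub_bord alpha i.1) Y x (map w i.2) (picked x B (l m)) ->
      fst_wins k%:R (sub_bord alpha i.1) Y x (map w i.2) (picked x B (l m)) (N m)].
Proof.
have /choice[g gP] (lm : nat * nat) : exists N, (lm.1 <= N)%N /\
    forall k (i : seq nat * seq nat) B, (k <= kappa lm.1 lm.2)%N -> (pickle i <= lm.2)%N ->
      ~ asy F k%:R (sub_bord alpha i.1) Y x (map w i.2) (picked x B lm.1) ->
      fst_wins k%:R (sub_bord alpha i.1) Y x (map w i.2) (picked x B lm.1) N.
  case: lm => l m /=.
  (* Only finitely many data matter at stage [m]: constants up to [kappa l m], codes up to [m], and
     subsets of the first [l] blocks, encoded as Boolean tuples. *)
  have [||N HN] := @finite_uniform
    ('I_(kappa l m).+1 * 'I_m.+1 * l.-tuple bool)%type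
    (fun t n => if (unpickle t.1.2 : option (seq nat * seq nat)) is Some i then
       let G := [seq x j | j <- mask t.2 (iota 0 l)] in
       ~ asy F t.1.1%:R (sub_bord alpha i.1) Y x (map w i.2) G ->
       fst_wins t.1.1%:R (sub_bord alpha i.1) Y x (map w i.2) G n
     else True).
  - move=> [[k j] b] n n' nn' /=; case: unpickle => // i H /H.
    exact: fst_wins_mono.
  - move=> [[k j] b] /=; case: unpickle => [i|]; last by exists 0%N.
    have [Ha|/fst_winsP [n Hn]] := pselect (asy F k%:R (sub_bord alpha i.1) Y x (map w i.2)
      [seq x j | j <- mask b (iota 0 l)]); first by exists 0%N.
    by exists n.
  (* The gap must also have room for [l] moved blocks. *)
  exists (maxn l N); split; first exact: leq_maxl.
  move=> k i B kk im Ha; apply: (@fst_wins_mono _ _ _ _ _ _ N); first exact: leq_maxr.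
  have kk' : (k < (kappa l m).+1)%N by [].
  have im' : (pickle i < m.+1)%N by [].
  have := HN (Ordinal kk', Ordinal im', map_tuple B (iota_tuple l 0)).
  by rewrite /= pickleK -filter_mask; apply.
pose l := fix l m := if m is n.+1 then (g (l n, n) + l n).+1 else 0%N.
exists l, (fun m => g (l m, m)); split => // m; first exact: (gP (l m, m)).1.
by move=> k i B kk im; exact: (gP (l m, m)).2.
Qed.

End Winning.

(** * Uniform choices along lists, and large elements of infinite sets *)

Lemma seq_uniform (T : eqType) (P : T -> nat -> Prop) (E : seq T) :
  (forall v m n, (m <= n)%N -> P v m -> P v n) ->
  (forall v, v \in E -> exists n, P v n) -> exists n, forall v, v \in E -> P v n.
Proof.
move=> Pmono; elim: E => [|a E IH] H; first by exists 0%N.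
have [m Hm] := H a (mem_head _ _).
have [n Hn] : exists n, forall v, v \in E -> P v n.
  by apply: IH => v vE; apply: H; rewrite inE vE orbT.
exists (maxn m n) => v; rewrite inE => /orP[/eqP ->|/Hn].
  by apply: Pmono Hm; exact: leq_maxl.
by apply: Pmono; exact: leq_maxr.
Qed.

Lemma seq_graph (T U : eqType) (Q : T -> U -> Prop) (E : seq T) :
  (forall v, v \in E -> exists b, Q v b) ->
  exists r : seq (T * U), map fst r = E /\ forall p, p \in r -> Q p.1 p.2.
Proof.
elim: E => [|a E IH] H; first by exists [::].
have [b Hb] := H a (mem_head _ _).
have [r [rE Hr]] : exists r : seq (T * U), map fst r = E /\ forall p, p \in r -> Q p.1 p.2.
  by apply: IH => v vE; apply: H; rewrite inE vE orbT.
exists ((a, b) :: r); split; first by rewrite /= rE.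
by move=> p; rewrite inE => /orP[/eqP -> //|/Hr].
Qed.

Lemma infinite_ge (A : set nat) n : infinite_set A -> exists2 m, A m & (n <= m)%N.
Proof.
move=> iA; apply: contrapT => H; apply: iA.
apply: (@sub_finite_set _ _ `I_n); last exact: finite_II.
move=> m Am /=; rewrite ltnNge; apply/negP => nm; apply: H; by exists m.
Qed.

(** * The rank bound when player I wins the asymptotic games *)

Section AsymptoticSide.
Variables (R : realType) (V : completeNormedModType R) (e : nat -> V) (F : set R).
Hypothesis he : schauder_basis e.
Hypothesis hF : is_subfield F.
Hypothesis hFc : countable F.
Hypothesis hFn : norm_closed e F.

Lemma norm_inW v : inW e F v -> F `|v|.
Proof.
move=> [[|m] [a [Fa ->]]]; last exact: hFn.
by rewrite big_ord0 normr0; exact: F0.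
Qed.

(* The intervals are the gaps [l m, N m + l m].  Given [A], all [x j] below the first
   gap used are moved into that gap once and for all, at the cost of a constant
   depending on [l m0] only; every other gap of [A] is skipped anyway, so a sequence
   avoiding these gaps is a play of II against a winning strategy of I. *)
Theorem asy_escape (alpha : bord) (x y : nat -> V) :
  block_seq e F x -> (forall n, spn F (range x) (y n)) ->
  (forall k : nat, (0 < k)%N -> ~ asy F k%:R alpha (spn F (range y)) x [::] [::]) ->
  exists I : nat -> nat * nat, interval_seq I /\
    forall A : set nat, infinite_set A ->
      Emb_le y (fspan_on F x (fun j => ~ in_union I A j)) (omega_mul alpha).
Proof.
move=> bx yx noasy.
have [C C0 HC] := basis_constant he.
have [c cx] := block_cuts he bx.
have x_neq0 j : x j != 0 by have [H _] := bx; case: (H j).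
have xW j : inW e F (x j) by have [H _] := bx; case: (H j).
have [w [wW wS]] := inW_enum e hF hFc.
set Y := spn F (range y).
have YW : Y `<=` inW e F.
  apply: subset_trans (block_inW hF bx).
  by apply: spn_trans; [exact: FM|move=> _ [i _ <-]].
pose w2 n : V * V := if unpickle n is Some p then (w p.1, w p.2) else 0.
have w2S (s : seq (V * V)) :
    (forall p, p \in s -> inW e F p.1 /\ inW e F p.2) -> exists i, s = map w2 i.
  elim: s => [|[u v] s IH] sW; first by exists [::].
  have [i ->] : exists i, s = map w2 i by apply: IH => p ps; apply: sW; rewrite inE ps orbT.
  have [/= /wS [m <-] /wS[n <-]] := sW (u, v) (mem_head _ _).
  by exists (pickle (m, n) :: i); rewrite /= /w2 pickleK.
pose cn := Num.bound (4 * C).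
have [l [N [lN lS good]]] := gaps F alpha w2 Y x (fun lm m => (m * (1 + cn * lm))%N).
have lmono m m' : (m <= m')%N -> (l m <= l m')%N.
  apply: (@homo_leq _ l leq leqnn leq_trans) => i.
  by rewrite lS -addnS; apply: leq_trans (leq_addl _ _); exact: leqnSn.
have l_ge m : (m <= l m)%N.
  elim: m => [//|m IH]; rewrite lS ltnS; exact: leq_trans IH (leq_addl _ _).
have l_gap m m' : (m < m')%N -> (N m + l m < l m')%N by move=> /lmono; rewrite lS.
pose I m := (l m, N m + l m)%N.
exists I; split=> [m|A iA K K1].
  by rewrite /I /= lS leq_addl ltnSn.
have K0 : 0 < K by exact: lt_le_trans K1.
pose code (p : seq nat) (i : seq nat) := pickle (p, i).
(* The first gap used comes late enough to account for the initial position and for the constant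
   [K]. *)
have [m0 Am0 m0_ge] := infinite_ge (maxn (code [::] [::]) (Num.bound K)) iA.
move: m0_ge; rewrite geq_max => /andP[m0_code m0_K].
set l0 := l m0; set N0 := N m0.
pose k := (m0 * (1 + cn * l0))%N.
have kbig : K * (1 + 4 * C * l0%:R) <= k%:R.
  have C4 : 0 <= 4 * C by rewrite mulr_ge0 // ltW.
  rewrite /k natrM natrD natrM; apply: ler_pM; first exact: ltW.
  - by rewrite addr_ge0 // mulr_ge0.
  - by apply: le_trans (ltW (archi_boundP (ltW K0))) _; rewrite ler_nat.
  - by rewrite lerD2l ler_wpM2r // ltW // archi_boundP.
pose avoid j := ~ in_union I A j.
pose mv := moved x N0.
pose S : set (V * V) := moving x l0 N0.
(* The part of [S] with sources avoiding [A]'s intervals and below [M], apart from the moved blocks;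
   its images lie in the span of finitely many generators. *)
pose SM M : set (V * V) := [set p | (exists2 j, (j < l0)%N & p = (x j, mv j)) \/
  (exists j, [/\ (N0 + l0 < j)%N, (j < M)%N, avoid j & p = (x j, x j)])].
have SMS M : SM M `<=` S.
  by move=> p [[j ? ->]|[j [? ? ? ->]]]; [left|right]; exists j.
have SMmono M M' : (M <= M')%N -> SM M `<=` SM M'.
  by move=> MM p [[j ? ->]|[j [? jM ? ->]]]; [left|right]; exists j => //; split => //; exact: leq_trans MM.
(* Allowed generators: the landing zone [[N0, N0 + l0)], which sits inside the skipped interval
   [I m0], and the avoiding blocks beyond that interval. *)
pose B j := ((N0 <= j)%N && (j < N0 + l0)%N) || ((N0 + l0 < j)%N && `[< avoid j >]).
pose G m := picked x B (l m).
have GW m : [set` G m] `<=` inW e F by move=> _ /= /mapP[j _ ->].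
have Gsplit m m' : (m <= m')%N ->
    G m' = G m ++ [seq x j | j <- iota (l m) (l m' - l m) & B j].
  by move=> /lmono lm; rewrite /G /picked -map_cat -filter_cat -iotaD subnKC.
(* Generators added after stage [m] are legal answers to the demand [N m]: the interval [I m] is
   skipped, except for the landing zone when [m = m0], and that starts at [N0]. *)
have Gtail m m' : A m -> (m0 <= m)%N ->
    [set` [seq x j | j <- iota (l m) (l m' - l m) & B j]] `<=` tl F x (N m).
  move=> Am m0m _ /= /mapP[j + ->]; rewrite mem_filter mem_iota => /and3P[Bj lj _].
  apply: spn_mem; [exact: F1|exists j => //=].
  case/orP: Bj => [/andP[N0j jN0]|/andP[N0j /asboolP avj]].
    have [<-//|m0_lt] := eqVneq m0 m.
    have : (N0 + l0 < l m)%N by apply: l_gap; rewrite ltn_neqAle m0_lt.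
    by move: lj jN0; lia.
  rewrite leqNgt; apply/negP => jN; apply: avj; exists m; split => //=.
  by split => //; apply: leq_trans (leq_addr _ _); exact: ltnW.
have SMG M m v : (M <= l m)%N -> (m0 < m)%N -> spn F (snd @` SM M) v -> spn F [set` G m] v.
  move=> Mm m0m; apply: spn_trans; first exact: FM.
  have inG j : B j -> (j < l m)%N -> spn F [set` G m] (x j).
    move=> Bj jl; apply: spn_mem; first exact: F1.
    by apply/mapP; exists j => //; rewrite mem_filter Bj mem_iota.
  move=> _ [p Hp <-]; case: Hp => [[j jl ->]|[j [Nj jM avj ->]]] /=.
    apply: spn_scale; first exact: FM.
      apply: FM => //; first exact: norm_inW.
      by apply: FV => //; [exact: norm_inW|rewrite normr_eq0].
    apply: inG; first by rewrite /B leq_addr ltn_add2l jl.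
    by apply: leq_trans (l_gap _ _ m0m); rewrite ltnS ltnW // ltn_add2l.
  apply: inG; last exact: leq_trans Mm.
  by rewrite /B Nj /= asboolT // orbT.
set Z := fspan_on F x (fun j => ~ in_union I A j).
have ZE : Z = spn F (x @` avoid) by exact: fspan_onE.
(* Send [v] through [t], then move the blocks. Entries of [t] avoid [I m0], so each of their blocks
   lies before [l0] or beyond [N0 + l0], where [S] is defined. *)
have reach t q v : Ttree y Z K t -> (q <= size t)%N ->
    spn F (y @` [set i | (i < q)%N]) v ->
    exists M b, relcomp (spn F (matching y t)) (spn F (SM M)) (v, b).
  move=> [tZ _] qt Hv.
  have [p Hp] : exists p, spn F (matching y t) (v, p).
    apply: spn_lift; apply: spn_sub Hv => _ [i /= iq <-].
    by exists (y i, nth 0 t i) => //; exists i => //=; exact: leq_trans qt.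
  have [M HM] : exists M, spn F (fst @` SM M) p.
    apply: spn_directed.
      by move=> M M' /SMmono MM _ [r Hr <-]; exists r => //; exact: MM.
    apply: (spn_trans (FM hF) _ (spn_snd Hp)) => _ [_ [i /= it <-] <-] /=.
    have := tZ i it; rewrite ZE; apply: spn_sub => _ [j avj <-].
    exists j.+1 => //; have [jl|lj] := ltnP j l0.
      by exists (x j, mv j) => //; left; exists j.
    exists (x j, x j) => //; right; exists j; split => //.
    rewrite ltnNge; apply/negP => jN; apply: avj; exists m0; split => //.
  have [b Hb] := spn_lift HM.
  by exists M, b, p.
pose Comp t := relcomp (spn F (matching y t)) (spn F S).
(* A node [t] of the tree provides II's answers [s], and I keeps a winning position with demand
   [N m]. At clock zero the norm estimates contradict I's win. *)
have claim p t s m : Ttree y Z K t -> [set` s] `<=` Comp t ->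
    (forall r, r \in s -> inW e F r.1 /\ inW e F r.2) -> A m -> (m0 <= m)%N ->
    fst_wins F k%:R (sub_bord alpha p) Y x s (G m) (N m) ->
    rank_lt (Ttree y Z K) t (omega_mul (sub_bord alpha p)).
  move Ec : (sub_bord alpha p) => d.
  elim: d p Ec t s m => [|d IH|f IH] p Ec t s m Tt st sW Am m0m /=.
  - case=> r Hr.
    have rel : relcomp (spn setT (matching y t)) (spn setT S) r.
      apply: (relcomp_spn (D := setT)) Hr => //; apply: subset_trans st _.
      by apply: relcomp_sub; exact: spn_coef.
    have l0N0 : (l0 <= N0)%N := lN m0.
    have c0 : 0 <= 1 + 4 * C * l0%:R by rewrite addr_ge0 // !mulr_ge0 // ltW.
    have [H1 H2] := relcomp_norm (ltW K0) c0 ((equivK_matching _ _ K0).1 Tt.2)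
      (moving_norm cx x_neq0 C0 HC l0N0) rel.
    by split; [apply: le_trans H1 _|apply: le_trans H2 _]; rewrite ler_wpM2r.
  - move=> [E [EY HE]].
    have [q Hq] : exists q, forall v, v \in E -> spn F (y @` [set i | (i < q)%N]) v.
      apply: seq_uniform => [v n n' nn'|v /EY Yv].
        by apply: spn_sub => _ [i /= i_n <-]; exists i => //=; exact: leq_trans nn'.
      apply: spn_directed.
        by move=> n n' nn' _ [i /= i_n <-]; exists i => //=; exact: leq_trans nn'.
      by apply: spn_sub Yv => _ [i _ <-]; exists i.+1 => //; exists i => /=.
    (* I's vectors involve only the first [q] terms of [y], so II can answer them once the node has
       [q] more entries. One round thus costs finitely many steps, hence [omega] per unit of the
       clock. *)
    exists q; apply: rank_lt_delay => // u Tu qu.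
    have [M HM] : exists M, forall v, v \in E ->
        exists b, relcomp (spn F (matching y (t ++ u))) (spn F (SM M)) (v, b).
      apply: seq_uniform => [v n n' nn' [b Hb]|v vE].
        by exists b; apply: relcomp_sub Hb => //; apply: spn_sub; exact: SMmono.
      apply: (reach _ q) => //; last exact: Hq.
      by rewrite size_cat; exact: leq_trans (leq_addl _ _).
    have [r [rE Hr]] := seq_graph HM.
    have rS m' v : (M <= l m')%N -> (m0 < m')%N -> v \in map snd r -> spn F [set` G m'] v.
      move=> Mm m0m' /mapP[z /Hr [a /= [_ Hz]] ->].
      by apply: (SMG M) => //; exact: (spn_snd Hz).
    have rW z : z \in r -> inW e F z.1 /\ inW e F z.2.
      move=> zr; split; first by apply: YW; apply: EY; rewrite /= -rE map_f.
      apply: (@spn_inW _ _ _ _ hF [set` G (maxn m0.+1 M)]); first exact: GW.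
      apply: rS; last exact: map_f.
        by apply: leq_trans (l_ge _); exact: leq_maxr.
      by exact: leq_maxl.
    have srW z : z \in s ++ r -> inW e F z.1 /\ inW e F z.2.
      by rewrite mem_cat => /orP[/sW|/rW].
    have [i si] := w2S (s ++ r) srW.
    (* The next gap lies past the current one, past the images of I's vectors, and past the code of
       the new position, so that [good] applies there. *)
    have [m' Am' Hm'] := infinite_ge (maxn m.+1 (maxn M (code (rcons p 0%N) i))) iA.
    move: Hm'; rewrite !geq_max => /and3P[mm' Mm' codem'].
    have m0m' : (m0 < m')%N by exact: leq_ltn_trans mm'.
    have Mlm' : (M <= l m')%N by exact: leq_trans (l_ge _).
    have dE : sub_bord alpha (rcons p 0%N) = d by rewrite sub_bord_rcons Ec.
    apply: (IH (rcons p 0%N) dE (t ++ u) (s ++ r) m') => //.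
    + move=> z /=; rewrite mem_cat => /orP[/st|/Hr].
        by apply: relcomp_sub => //; apply: spn_sub; exact: matching_cat.
      case: z => a b; apply: relcomp_sub => //; apply: spn_sub; exact: SMS.
    + exact: ltnW.
    + have := good m' k (rcons p 0%N, i) B; rewrite /= dE -si; apply => //.
        rewrite leq_mul //; first exact: ltnW.
        by rewrite leq_add2l leq_mul2l lmono ?orbT // ltnW.
      rewrite -/(G m') (Gsplit m m') 1?ltnW //; apply: HE; split => //.
        exact: Gtail.
      by rewrite -Gsplit 1?ltnW // => v; exact: rS.
  - move=> [i Hi]; exists i.
    have fE : sub_bord alpha (rcons p i) = f i by rewrite sub_bord_rcons Ec.
    exact: (IH i (rcons p i) fE t s m).
(* Allowed generators start at [N0 >= l0], so play begins with none. *)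
have G0 : G m0 = [::].
  rewrite /G /picked (eq_in_filter (a2 := pred0)) ?filter_pred0 // => j.
  rewrite mem_iota add0n /= => jl; apply/negbTE; rewrite negb_or !negb_and -!leqNgt -ltnNge.
  have := lN m0; rewrite -/l0 -/N0 => lN0.
  by rewrite (leq_trans jl lN0) /=; apply/orP; left; move: jl lN0; rewrite -/l0; lia.
have subE : sub_bord alpha [::] = alpha by case: (alpha).
move=> t Tt; have := claim [::] t [::] m0 Tt; rewrite subE; apply => //.
have := good m0 k ([::], [::]) B; rewrite /= subE -/(G m0) G0; apply => //.
apply: noasy; rewrite -(ltr0n R); apply: lt_le_trans kbig.
by rewrite mulr_gt0 // ltr_wpDr // !mulr_ge0 // ltW.
Qed.

End AsymptoticSide.

(** * The dichotomy for block subspaces *)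

Theorem theorem4p11 (R : realType) (V : completeNormedModType R)
  (e : nat -> V) (F : set R)
  (he : schauder_basis e)
  (hF : is_subfield F) (hFc : countable F) (hFn : norm_closed e F)
  (alpha : bord) :
  exists x : nat -> V,
    block_seq e F x /\
    ((forall y : nat -> V,
        block_seq e F y -> normalised y -> (forall n, fspan F x (y n)) ->
        exists I : nat -> nat * nat,
          interval_seq I /\
          forall A : set nat, infinite_set A ->
            Emb_le y (fspan_on F x (fun j => ~ in_union I A j)) (omega_mul alpha))
     \/
     (forall u : nat -> V, block_seq e F u -> fspan F u `<=` fspan F x ->
        forall z : nat -> V, block_seq e F z -> (forall n, fspan F x (z n)) ->
          ~ Emb_le z (fspan F u) alpha)).
Proof.
have be : block_seq e F e.
  split=> n; first split; [|exact: basis_neq0|].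
    by apply/(inWE _ hF); apply: spn_mem; [exact: F1|exists n].
  apply: (@blk_ltP _ _ _ he n.+1) => k kn; rewrite co_basis.
    by rewrite gtn_eqF.
  by rewrite ltn_eqF.
(* A single [x] decides the initial position for all integer constants [k.+1] at once. *)
have [x [bx _ Hx]] := block_fusion he hF
  (fun k => @decided_mono _ _ _ _ he hF k.+1%:R alpha [::] [::])
  (fun k y => @decided_dense _ _ _ _ he hF hFc k.+1%:R alpha [::] [::] y
     (fun _ => ltac:(by [])))  be.
have [[k Hk]|H] := pselect (exists k : nat, asy_below e F k.+1%:R alpha [::] [::] x).
  have Hg := Hx k Hk; have [y [by_ yx Ha]] := Hk.
  exists y; split => //; right=> u bu; rewrite (fspanE hF y) => uy z bz zy Hemb.
  have k0 : (0 : R) < k.+1%:R by rewrite ltr0n.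
  have ux : le_blk F u x.
    move=> j; apply: (le_blk_span hF yx); apply: uy.
    by rewrite fspanE //; exact: le_blk_refl.
  apply: (compose_strategies hF k0 bu ux zy (t := [::]) Ha Hg) => //.
    by move=> p [i].
  (* The composite of two equivalences with constant [k.+1] has constant [k.+1 * k.+1], and the
     empty sequence is the root of that tree. *)
  apply: Hemb.
    by rewrite -[leLHS]mulr1 ler_pM // ler1n.
  split=> // a; rewrite !big_ord0 !normr0 !mulr0; by split.
exists x; split => //; left=> y by_ _ yx.
apply: (asy_escape he hF hFc hFn bx) => [n|k k0 Ha]; first by rewrite -fspanE.
apply: H; exists k.-1; rewrite prednK //; exists y; split => // j.
by rewrite -fspanE.
Qed.
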